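(* Let $U\subset\mathbb{R}^n$ be a bounded Lipschitz domain, $h\in(0,1)$, $q\in(0,n/h)$, and $q^*_h:=nq/(n-hq)$. Then for any $\tilde q\in[q,q^*_h)$, the embedding of $W^{h,q}(U)$ into $L^{\tilde q}(U)$ is compact.
   Context: $n\ge2$. For $U\subseteq\mathbb{R}^n$ open, $h\in(0,1)$ and $q\in(0,\infty)$ (values $q<1$ allowed), $W^{h,q}(U)$ is the set of measurable $f$ with $\|f\|^q_{W^{h,q}(U)}:=\int_U|f|^q\,dx+\int_U\int_U\frac{|f(x)-f(y)|^q}{|x-y|^{n+hq}}\,dx\,dy<\infty$; for $q<1$ this is only a quasinorm. Compactness means that every sequence bounded in $\|\cdot\|_{W^{h,q}(U)}$ has a subsequence $\{f_j\}$ and a function $f\in L^{\tilde q}(U)$ with $\int_U|f_j-f|^{\tilde q}\,dx\to0$. *)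

(* Defs.v *)
From HB Require Import structures.
From mathcomp Require Import all_boot all_order all_algebra.
From mathcomp Require Import all_classical all_reals all_analysis.

Set Implicit Arguments.
Unset Strict Implicit.
Unset Printing Implicit Defensive.

Import Order.TTheory GRing.Theory Num.Theory.
Import numFieldNormedType.Exports.

Local Open Scope classical_set_scope.
Local Open Scope ring_scope.

(* The sigma-algebra on R^n generated by the coordinates, as the library does
   for n.-tuple R: it is the Borel sigma-algebra of R^n. *)
Definition rV_measure_display : measure_display.
Proof. exact: default_measure_display. Qed.

Section rV_measurable.
Context {R : realType} {n : nat}.

Let coord (i : 'I_n) (v : 'rV[R]_n) : measurableTypeR R := v ord0 i.

Let rV_set0 : g_sigma_preimage coord set0.
Proof. exact: sigma_algebra0. Qed.

Let rV_setC A : g_sigma_preimage coord A -> g_sigma_preimage coord (~` A).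
Proof. exact: sigma_algebraC. Qed.

Let rV_bigcup (F : (set 'rV[R]_n)^nat) :
  (forall i, g_sigma_preimage coord (F i)) ->
  g_sigma_preimage coord (\bigcup_i F i).
Proof. exact: sigma_algebra_bigcup. Qed.

HB.instance Definition _ := @isMeasurable.Build
  rV_measure_display 'rV[R]_n (g_sigma_preimage coord) rV_set0 rV_setC rV_bigcup.

Lemma measurable_rV_coord (i : 'I_n) :
  measurable_fun [set: 'rV[R]_n] (fun v => v ord0 i : measurableTypeR R).
Proof.
move=> _ Y mY; rewrite setTI; apply: sub_sigma_algebra => /=.
rewrite -bigcup_seq/=; exists i => /=; first by rewrite mem_index_enum.
by exists Y => //; rewrite setTI.
Qed.

Lemma measurable_to_rV d (T : measurableType d) (f : T -> 'rV[R]_n) :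
  (forall i, measurable_fun [set: T] (fun t => f t ord0 i : measurableTypeR R)) ->
  measurable_fun [set: T] f.
Proof.
move=> mf _ A mA; rewrite setTI.
pose S := [set B : set 'rV[R]_n | measurable (f @^-1` B)].
apply: (_ : measurable `<=` S) A mA.
apply: smallest_sub.
  split; rewrite /S/=.
  - by rewrite preimage_set0.
  - by move=> B mB; rewrite setTD preimage_setC; exact: measurableC.
  - by move=> F mF; rewrite preimage_bigcup; exact: bigcup_measurable.
move=> B; rewrite -bigcup_seq => -[i _ [Y mY <-]].
by rewrite /S/= setTI -[X in measurable X]setTI; exact: (mf i).
Qed.

End rV_measurable.

Section rV_cons.
Context {R : realType} {n : nat}.

Definition rV_cons (p : measurableTypeR R * 'rV[R]_n) : 'rV[R]_n.+1 :=
  row_mx (p.1%:M : 'M[R]_1) p.2.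

Definition rV_uncons (v : 'rV[R]_n.+1) : measurableTypeR R * 'rV[R]_n :=
  (v ord0 ord0, rsubmx (v : 'rV[R]_(1 + n))).

Lemma rV_consK : cancel rV_cons rV_uncons.
Proof.
move=> [x v]; congr (_, _); last exact: row_mxKr.
rewrite (_ : ord0 = lshift n (ord0 : 'I_1)); last exact: val_inj.
by rewrite [LHS]row_mxEl mxE eqxx mulr1n.
Qed.

Lemma measurable_rV_cons : measurable_fun setT rV_cons.
Proof.
apply: measurable_to_rV => i; rewrite /rV_cons.
have [j|j] := splitP (i : 'I_(1 + n)) => ij.
- have -> : i = lshift n j by exact: val_inj.
  rewrite (_ : (fun _ => _) = fst); first exact: measurable_fst.
  by apply/funext => p; rewrite [LHS]row_mxEl mxE (ord1 j) eqxx mulr1n.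
- have -> : i = rshift 1 j by exact: val_inj.
  rewrite (_ : (fun _ => _) =
      (fun v : 'rV[R]_n => v ord0 j : measurableTypeR R) \o snd).
    exact: (measurableT_comp (measurable_rV_coord j) measurable_snd).
  by apply/funext => p; rewrite [LHS]row_mxEr.
Qed.

Lemma measurable_rV_uncons : measurable_fun setT rV_uncons.
Proof.
apply: measurable_fun_pair; first exact: measurable_rV_coord.
apply: measurable_to_rV => i.
rewrite (_ : (fun _ => _) =
  fun v : 'rV[R]_n.+1 => v ord0 (rshift 1 i) : measurableTypeR R).
  exact: measurable_rV_coord.
by apply/funext => v; rewrite mxE.
Qed.

Variable m : {sigma_finite_measure set 'rV[R]_n -> \bar R}.

Definition rV_next : set 'rV[R]_n.+1 -> \bar R :=
  pushforward (lebesgue_measure \x m)%E rV_cons.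

Let rV_next0 : rV_next set0 = 0%E.
Proof. by rewrite /rV_next /pushforward preimage_set0 measure0. Qed.

Let rV_next_ge0 A : (0 <= rV_next A)%E.
Proof. by rewrite /rV_next /pushforward. Qed.

Let rV_next_sigma_additive : semi_sigma_additive rV_next.
Proof.
move=> F mF tF mUF; rewrite /rV_next /pushforward preimage_bigcup.
apply: measure_semi_sigma_additive.
- by move=> k; rewrite -[X in measurable X]setTI; exact: measurable_rV_cons.
- apply/trivIsetP => /= i j _ _ ij; rewrite -preimage_setI.
  by move/trivIsetP : tF => /(_ _ _ _ _ ij) ->//; rewrite preimage_set0.
- rewrite -preimage_bigcup -[X in measurable X]setTI.
  exact: measurable_rV_cons.
Qed.

HB.instance Definition _ := isMeasure.Build _ _ _ rV_next
  rV_next0 rV_next_ge0 rV_next_sigma_additive.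

Let rV_next_sigma_finite : sigma_finite setT rV_next.
Proof.
have /sigma_finiteP[F [TF ndF Foo]] := sigma_finiteT (@lebesgue_measure R).
have /sigma_finiteP[G [TG ndG Goo]] := sigma_finiteT m.
exists (fun k => rV_uncons @^-1` (F k `*` G k)).
  apply/esym/seteqP; split=> // v _.
  have [i _ Fi] : (\bigcup_k F k) (rV_uncons v).1 by rewrite -TF.
  have [j _ Gj] : (\bigcup_k G k) (rV_uncons v).2 by rewrite -TG.
  exists (maxn i j) => //; split.
  - by move: Fi; exact/subsetPset/ndF/leq_maxl.
  - by move: Gj; exact/subsetPset/ndG/leq_maxr.
move=> k; have [mF Fk] := Foo k; have [mG Gk] := Goo k; split.
  rewrite -[X in measurable X]setTI; apply: measurable_rV_uncons => //.
  exact: measurableX.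
rewrite /rV_next /pushforward -comp_preimage.
rewrite (_ : rV_uncons \o rV_cons = id); last exact/funext/rV_consK.
by rewrite preimage_id product_measure1E// lte_mul_pinfty// ge0_fin_numE.
Qed.

HB.instance Definition _ := Measure_isSigmaFinite.Build _ _ _ rV_next
  rV_next_sigma_finite.

End rV_cons.

Fixpoint borel_lebesgue_rV (R : realType) (n : nat) :
    {sigma_finite_measure set 'rV[R]_n -> \bar R} :=
  match n with
  | 0 => \d_(0 : 'rV[R]_0)
  | k.+1 => rV_next (borel_lebesgue_rV R k)
  end.

(* R^n with the Lebesgue sigma-algebra, and the Lebesgue measure on it, built as
   the library builds completed_lebesgue_measure in dimension one. *)
Notation lebesgue_space R n :=
  (caratheodory_type (mu_ext (borel_lebesgue_rV R n))).

Definition lebesgue_rV (R : realType) (n : nat) :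
    {measure set (lebesgue_space R n) -> \bar R} :=
  @completed_measure_extension _ _ _ (borel_lebesgue_rV R n).

Section sobolev.
Context {R : realType} {n : nat}.
Implicit Types (U : set 'rV[R]_n) (f g : 'rV[R]_n -> R).

(* The norm carried by 'rV[R]_n in the library is the sup norm. *)
Definition euclidean_dist k (x y : 'rV[R]_k) : R :=
  Num.sqrt (\sum_(i < k) (x ord0 i - y ord0 i) ^+ 2).

Definition lebesgue_measurable_on U f :=
  measurable_fun (U : set (lebesgue_space R n)) (f : lebesgue_space R n -> R).

Definition int_pow U (p : R) f : \bar R :=
  (\int[lebesgue_rV R n]_(x in U) (`|f x| `^ p)%:E)%E.

Definition Lspace U (p : R) : set ('rV[R]_n -> R) :=
  [set f | lebesgue_measurable_on U f /\ (int_pow U p f < +oo)%E].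

(* On the diagonal the integrand is 0 / 0 = 0. *)
Definition gagliardo U (h q : R) f : \bar R :=
  (\int[lebesgue_rV R n]_(x in U) \int[lebesgue_rV R n]_(y in U)
     (`|f x - f y| `^ q / euclidean_dist x y `^ (n%:R + h * q))%:E)%E.

Definition sobolev_norm U (h q : R) f : \bar R :=
  ((int_pow U q f + gagliardo U h q f) `^ q^-1)%E.

Definition sobolev U (h q : R) : set ('rV[R]_n -> R) :=
  [set f | lebesgue_measurable_on U f /\ (sobolev_norm U h q f < +oo)%E].

Definition compactly_embedded U (h q p : R) :=
  sobolev U h q `<=` Lspace U p /\
  forall f_ : nat -> 'rV[R]_n -> R,
    (forall j, sobolev U h q (f_ j)) ->
    (exists M : R, forall j, (sobolev_norm U h q (f_ j) <= M%:E)%E) ->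
    exists phi : nat -> nat, {homo phi : i j / (i < j)%N} /\
    exists2 f, Lspace U p f &
      int_pow U p (f_ (phi j) \- f) @[j --> \oo] --> 0%E.

(* Near x0 and in the orthonormal coordinates x *m Q, U is the strict epigraph
   of a Lipschitz function gamma of the n - 1 coordinates other than the i-th. *)
Definition lipschitz_epigraph_near U (x0 : 'rV[R]_n) :=
  exists (r L : R) (Q : 'M[R]_n) (i : 'I_n) (gamma : 'rV[R]_n.-1 -> R),
    [/\ 0 < r, Q *m Q^T = 1%:M,
        forall y z, `|gamma y - gamma z| <= L * euclidean_dist y z
      & forall x, euclidean_dist x x0 < r ->
          (U x <-> gamma (col' i (x *m Q)) < (x *m Q) ord0 i)].

Definition bounded_lipschitz_domain U :=
  [/\ U !=set0, open U, connected U, bounded_set U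
    & forall x0, (closure U `\` U^°) x0 -> lipschitz_epigraph_near U x0].

End sobolev.

(* Main.v *)
Require Import Defs.
From HB Require Import structures.
From mathcomp Require Import all_boot all_order all_algebra.
From mathcomp Require Import all_classical all_reals all_analysis.
From mathcomp Require Import measurable_realfun ring lra.

Set Implicit Arguments.
Unset Strict Implicit.
Unset Printing Implicit Defensive.

Import Order.TTheory GRing.Theory Num.Theory.
Import numFieldNormedType.Exports.

Local Open Scope classical_set_scope.
Local Open Scope ring_scope.

(** The proof runs in a metric measure space: a metric [dist], a measure [mu]
    and a totally bounded set [U] of finite measure with the lower volume bound
    [mu (U cap B(x, r)) >= c r^s] for [x] in [U] and small [r]. In the end
    [s = n], and a bounded Lipschitz domain satisfies this bound because, near
    each of its points and at every small scale, it contains a ball of radius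
    comparable to the scale ([lipschitz_corkscrew]). Sums of powers are handled
    by [(u + v)^q <= 2^q (u^q + v^q)], so that the argument is the same for
    [q < 1] and [q >= 1].

    Let [G x] be the inner integral of the Gagliardo seminorm ([energy]), so
    that the integral of [G] is bounded on a bounded subset of the Sobolev
    space. Integrating [|f x - f y|^q <= 2^q (|f x - f z|^q + |f z - f y|^q)]
    over [z] in [U cap B(y, r)] gives a pointwise Hoelder estimate in the style
    of Hajlasz ([energy_hoelder]):
      [|f x - f y|^q <= C r^(h q) (G x + G y)]  whenever [dist x y < r].

    Higher integrability follows from a chain argument. By Chebyshev and the
    volume bound, for large [a] every [x] lies within about [a^(-1/s)] of a
    point where [G <= a]; moving from [G <= 2 a] to [G <= a] thus changes [f] by
    at most [C a^b], where [b = (1/q) (1 - h q / s)] is the reciprocal of the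
    critical exponent, and summing the geometric series in dyadic [a] gives
    [|f| <= C (1 + G)^b] ([energy_growth]).

    For compactness in [L^p] with [b p < 1], the part of [|f - g|^p] where [G]
    is large is absorbed by [e (1 + G_f + G_g)], because [b p < 1]. On the
    sublevel [G <= K] all functions are equicontinuous and bounded, so that
    finitely many rounded samples determine them up to [e]. Hence the bounded
    set splits into finitely many classes such that
    [|f - g|^p <= e (1 + G_f + G_g)] pointwise on [U] for [f] and [g] in one
    class ([energy_coloring]). A diagonal argument then extracts a subsequence
    which is Cauchy in [L^p] at a geometric rate ([diagonal_subsequence]), and
    such a sequence has a limit by Fatou's lemma ([fast_cauchy_cvg]). *)

(** * Powers of real numbers *)

Section powR_facts.
Context {R : realType}.
Implicit Types a b c e q u v : R.

(** The substitute, valid for every exponent, for the convexity of [t |-> t^q]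
    when [q >= 1] and for its subadditivity when [q <= 1]. *)
Lemma powRD_le u v q : 0 <= u -> 0 <= v -> 0 <= q ->
  (u + v) `^ q <= 2 `^ q * (u `^ q + v `^ q).
Proof.
move=> u0 v0 q0; wlog uv : u v u0 v0 / u <= v.
  move=> wl; have [uv|/ltW vu] := leP u v; first exact: wl.
  by rewrite (addrC u) (addrC (u `^ q)); exact: wl.
apply: (@le_trans _ _ ((2 * v) `^ q)).
  by apply: ge0_ler_powR => //; rewrite ?nnegrE; lra.
by rewrite powRM// ler_wpM2l ?powR_ge0// lerDr powR_ge0.
Qed.

Lemma powR_dist_le a b c q : 0 <= q ->
  `|a - b| `^ q <= 2 `^ q * (`|a - c| `^ q + `|c - b| `^ q).
Proof.
move=> q0; apply: le_trans (powRD_le _ _ q0) => //.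
by apply: ge0_ler_powR => //; rewrite ?nnegrE ?addr_ge0// ler_distD.
Qed.

Lemma powR_le_root u v q : 0 < q -> 0 <= u -> 0 <= v -> u `^ q <= v -> u <= v `^ q^-1.
Proof.
move=> q0 u0 v0 uv.
rewrite -[leLHS](powRr1 u0) -(mulfV (lt0r_neq0 q0)) powRrM.
by apply: ge0_ler_powR => //; rewrite ?nnegrE ?powR_ge0// invr_ge0 ltW.
Qed.

Lemma powR_le_cancel u v q : 0 < q -> 0 <= u -> 0 <= v -> u `^ q <= v `^ q -> u <= v.
Proof.
move=> q0 u0 v0 /(powR_le_root q0 u0 (powR_ge0 _ _)).
by rewrite -powRrM mulfV ?gt_eqF// powRr1.
Qed.

Lemma root_powR_le u v q : 0 < q -> 0 <= u -> 0 <= v -> u <= v `^ q^-1 -> u `^ q <= v.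
Proof.
move=> q0 u0 v0 uv.
rewrite -[leRHS](powRr1 v0) -(mulVf (lt0r_neq0 q0)) powRrM.
by apply: ge0_ler_powR => //; rewrite ?nnegrE ?powR_ge0// ltW.
Qed.

Lemma powR_exprn u b k : 0 <= u -> (u ^+ k) `^ b = (u `^ b) ^+ k.
Proof.
by move=> u0; rewrite -(powR_mulrn k u0) -(powR_mulrn k (powR_ge0 u b)) powRAC.
Qed.

Lemma powR_gt1 u b : 1 < u -> 0 < b -> 1 < u `^ b.
Proof.
move=> u1 b0; have := gt0_ltr_powR b0 (ler01 : 1 \in Num.nneg).
by move=> /(_ u); rewrite powR1; apply => //; rewrite nnegrE; lra.
Qed.

Lemma power2_bounds (a : R) : 1 <= a -> exists k, a <= 2 ^+ k <= 2 * a.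
Proof.
move=> a1.
have ex : exists k, a <= 2 ^+ k.
  exists (Num.bound a); apply: (@le_trans _ _ (Num.bound a)%:R).
    by apply/ltW/archi_boundP; lra.
  by rewrite -natrX ler_nat ltnW// ltn_expl.
case: (ex_minnP ex) => -[|k] ak kmin; [exists 0%N|exists k.+1].
- by rewrite ak expr0; lra.
- rewrite ak/= exprS ler_pM2l// leNgt; apply/negP => /ltW /kmin.
  by rewrite ltnn.
Qed.

(** A power of exponent below one is absorbed by a small multiple of its
    argument at infinity; this is where a subcritical exponent is strictly
    better than the critical one. *)
Lemma sublinear_absorb D b e : 0 <= D -> b < 1 -> 0 < e ->
  exists2 K, 1 <= K & forall t, K <= t -> D * t `^ b <= e * t.
Proof.
move=> D0 b1 e0; exists (Num.max 1 ((D / e) `^ (1 - b)^-1)).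
  by rewrite le_max lexx.
move=> t; rewrite ge_max => /andP[t1 Dt].
have t0 : 0 < t by lra.
have Det : D <= e * t `^ (1 - b).
  rewrite mulrC -ler_pdivrMr//.
  rewrite -[1 - b]invrK; apply: powR_le_root => //.
  - by rewrite invr_gt0; lra.
  - by rewrite divr_ge0// ltW.
  - exact: ltW.
have tE : t `^ (1 - b) * t `^ b = t.
  rewrite -powRD ?subrK ?powRr1 ?(ltW t0)//.
  by apply/implyP => _; rewrite gt_eqF.
by rewrite -[X in _ <= e * X]tE mulrA ler_wpM2r// powR_ge0.
Qed.

(** Rounding to a grid of step [e] turns approximate equality of bounded real
    numbers into equality of finitely many codes. It
    is applied to the values of functions and to the coordinates of points. *)
Lemma quantization (A e : R) : 0 < e -> exists N (code : R -> 'I_N.+1),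
  forall u v, `|u| <= A -> `|v| <= A -> code u = code v -> `|u - v| <= e.
Proof.
move=> e0; pose N := Num.truncn (2 * A / e).
exists N, (fun u => inord (Num.truncn ((u + A) / e))) => u v uA vA.
have trunc_small w : `|w| <= A -> (Num.truncn ((w + A) / e) < N.+1)%N.
  rewrite ler_norml => /andP[_ wA]; rewrite ltnS /N; apply: le_truncn.
  by rewrite ler_wpM2r ?invr_ge0 ?(ltW e0)//; lra.
move=> /(congr1 (@nat_of_ord _)); rewrite !inordK ?trunc_small// => uv.
have itv w : `|w| <= A -> let k := (Num.truncn ((w + A) / e))%:R in
    k * e <= w + A < (k + 1) * e.
  rewrite ler_norml => /andP[wA _] /=.
  have := @truncn_itv _ ((w + A) / e); rewrite divr_ge0 ?(ltW e0)//; last lra.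
  by move=> /(_ isT); rewrite -natr1 ler_pdivlMr// ltr_pdivrMr.
have /= := itv u uA; have /= := itv v vA; rewrite uv.
set k := _%:R => /andP[v1 v2] /andP[u1 u2].
by rewrite ler_norml; apply/andP; split; lra.
Qed.

End powR_facts.

(** * Diagonal subsequences and completeness of [L^p] for all positive [p] *)

Lemma measurable_powR_norm (R : realType) (d' : measure_display) (T' : measurableType d')
    (D : set T') (g : T' -> R) p : measurable_fun D g ->
  measurable_fun D (fun t => (`|g t| `^ p)%:E).
Proof.
move=> mg; apply/measurable_EFinP.
apply: (measurableT_comp (f := @powR R ^~ p) (g := fun t => `|g t|)) => //.
exact: measurableT_comp.
Qed.

(** A free ultrafilter chooses, for each colouring, the colour of a large set of
    indices, all at once and compatibly: finitely many such sets and a tail of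
    the integers always meet. *)
Lemma diagonal_subsequence (C : nat -> finType) (col : forall m, nat -> C m) :
  exists phi : nat -> nat, {homo phi : i j / (i < j)%N} /\
    forall m i j, (m <= i)%N -> (m <= j)%N -> col m (phi i) = col m (phi j).
Proof.
have [G [ultraG ooG]] := @ultraFilterLemma _ \oo _.
have major m : exists t : C m, G [set n | col m n = t].
  apply: contrapT => no; have : G [set n | forall t, col m n <> t].
    apply: filter_forall => t.
    by have [Gt|//] := in_ultra_setVsetC [set n | col m n = t] ultraG; case: no; exists t.
  by move=> /filter_ex[n /(_ (col m n))].
pose t m := projT1 (cid (major m)).
have tP m : G [set n | col m n = t m] by exact: projT2 (cid (major m)).
have step m N : exists n, (N <= n)%N /\ forall j, (j <= m)%N -> col j n = t j.
  have G1 : G [set n | forall j : 'I_m.+1, col j n = t j].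
    by apply: filter_forall => j; exact: tP.
  have G2 : G [set n | (N <= n)%N] by apply: ooG; exact: nbhs_infty_ge.
  have : G ([set n | forall j : 'I_m.+1, col j n = t j] `&` [set n | (N <= n)%N]).
    exact: filterI.
  move=> /filter_ex[n [/= nj Nn]].
  exists n; split => // j jm; exact: (nj (Ordinal (jm : (j < m.+1)%N))).
pose next m N := projT1 (cid (step m N)).
have nextP m N := projT2 (cid (step m N)).
pose phi := fix phi k := if k is k'.+1 then next k (phi k').+1 else next 0%N 0%N.
have phi_col k j : (j <= k)%N -> col j (phi k) = t j.
  by case: k => [|k]; exact: (nextP _ _).2.
exists phi; split.
  apply: homo_ltn; first exact: ltn_trans.
  by move=> k; exact: (nextP _ _).1.
by move=> m i j mi mj; rewrite !phi_col.
Qed.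

Section convergence.
Context {R : realType}.

(** At [l = 0] the map [t |-> t^p] is not differentiable when [p < 1], which
    is why this point is treated apart. *)
Lemma cvg_powR_norm (u : nat -> R) l p : 0 < p -> u @ \oo --> l ->
  `|u n| `^ p @[n --> \oo] --> `|l| `^ p.
Proof.
move=> p0 ul; have nul : `|u n| @[n --> \oo] --> `|l| by exact: cvg_norm.
have [l0|l0] := eqVneq l 0.
  rewrite l0 normr0 powR0 ?gt_eqF//; apply/cvgrPdist_le => e e0.
  move: ul; rewrite l0 => /cvgrPdist_le /(_ _ (powR_gt0 p^-1 e0)).
  apply: filterS => n; rewrite !sub0r !normrN (ger0_norm (powR_ge0 _ _)) => un.
  rewrite -[e]powRr1 ?(ltW e0)// -(mulVf (lt0r_neq0 p0)) powRrM.
  by apply: ge0_ler_powR => //; rewrite ?nnegrE ?powR_ge0 ?(ltW p0).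
have l_gt0 : 0 < `|l| by rewrite normr_gt0.
apply: (@cvg_comp _ _ _ (fun n => `|u n|) (fun v => v `^ p) _ _ _ nul).
have dl : derivable (@powR R ^~ p) `|l| 1.
  by apply: derivable_powR; rewrite in_itv/= andbT.
have : {for `|l|, continuous (@powR R ^~ p)}.
  by apply: differentiable_continuous; exact/derivable1_diffP.
exact.
Qed.

Lemma geometric_increments_cvg (u : nat -> R) a z : 0 <= z < 1 ->
  (forall n, `|u n.+1 - u n| <= a * z ^+ n) -> cvgn u.
Proof.
move=> /andP[z0 z1] uaz.
have a0 : 0 <= a by have := uaz 0%N; rewrite expr0 mulr1; exact: le_trans.
have -> : u = (fun n => u 0%N + series (telescope u) n).
  by apply/funext => n; exact: eq_sum_telescope.
apply: is_cvgD; first exact: is_cvg_cst.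
apply: normed_cvg; apply: (@series_le_cvg _ _ (geometric a z)) => //.
- by move=> n; exact: normr_ge0.
- by move=> n; rewrite /geometric/= mulr_ge0// exprn_ge0.
- by apply: is_cvg_geometric_series; rewrite ger0_norm.
Qed.

End convergence.

Section completeness.
Context {R : realType} {disp : measure_display} {T : measurableType disp}.
Variables (mu : {measure set T -> \bar R}) (U : set T) (p : R).
Hypotheses (mU : measurable U) (p0 : 0 < p).

(** The series of [2^k |F k.+1 x - F k x|^p] has a finite integral, hence a
    finite sum at almost every [x]; there the increments are bounded by a
    geometric sequence of ratio [2^(-1/p)]. *)
Lemma fast_cauchy_ae_cvg (F : nat -> T -> R) (W : R) :
  (forall k, measurable_fun U (F k)) ->
  (forall k, (\int[mu]_(x in U) (`|F k.+1 x - F k x| `^ p)%:E <=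
     (W / 4 ^+ k)%:E)%E) ->
  {ae mu, forall x, U x -> cvgn (F ^~ x)}.
Proof.
move=> mF FW.
pose t k x : \bar R := ((2 ^+ k * `|F k.+1 x - F k x| `^ p)%:E)%E.
have t0 k x : (0 <= t k x)%E by rewrite lee_fin mulr_ge0 ?powR_ge0 ?exprn_ge0.
have mt k : measurable_fun U (t k).
  apply/measurable_EFinP; apply: measurable_funM => //.
  apply/measurable_EFinP.
  by apply: (measurable_powR_norm (g := F k.+1 \- F k)); exact: measurable_funB.
pose H x : \bar R := (\sum_(k <oo) t k x)%E.
have W0 : 0 <= W.
  have := FW 0%N; rewrite expr0 divr1 -lee_fin; apply: le_trans.
  by apply: integral_ge0 => x _; rewrite lee_fin powR_ge0.
have H0 x : (0 <= H x)%E by exact: nneseries_ge0.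
have intH : (\int[mu]_(x in U) H x <= (2 * W)%:E)%E.
  rewrite integral_nneseries//.
  apply: le_trans (epsilon_trick0 xpredT (_ : 0 <= 2 * W)); last by rewrite mulr_ge0.
  apply: lee_nneseries => [k _ _|k _]; first by apply: integral_ge0 => x _.
  under eq_integral do rewrite /t EFinM.
  rewrite ge0_integralZl//; last first.
    by apply: (measurable_powR_norm (g := F k.+1 \- F k)); exact: measurable_funB.
  apply: (@le_trans _ _ ((2 ^+ k)%:E * (W / 4 ^+ k)%:E)%E).
    by rewrite lee_wpmul2l ?lee_fin ?exprn_ge0.
  rewrite -EFinM lee_fin natrX exprS (_ : 4 = 2 * 2 :> R); last by lra.
  rewrite exprMn le_eqVlt; apply/orP; left; apply/eqP; field.
  by rewrite expf_neq0.
have /integrable_ae : mu.-integrable U H.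
  apply/integrableP; split.
    by apply: (ge0_emeasurable_sum (P := xpredT)) => k *; [exact: t0|exact: mt].
  under eq_integral do rewrite gee0_abs//.
  exact: le_lt_trans intH (ltry _).
move=> /(_ mU); apply: filterS => x Hfin Ux.
have {}Hfin := Hfin Ux.
pose B := fine (H x).
have tB k : 2 ^+ k * `|F k.+1 x - F k x| `^ p <= B.
  rewrite -lee_fin fineK//.
  apply: le_trans (nneseries_lim_ge k.+1 _) => //.
  rewrite big_mkord big_ord_recr/= -[leLHS]add0e leeD// sume_ge0//.
have B0 : 0 <= B by apply: fine_ge0.
apply: (@geometric_increments_cvg R _ (B `^ p^-1) ((2^-1) `^ p^-1)).
  rewrite powR_ge0/=; have := @gt0_ltr_powR R p^-1; rewrite invr_gt0 => /(_ p0).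
  move=> /(_ 2^-1 1); rewrite powR1; apply; rewrite ?nnegrE//; lra.
move=> k; rewrite -powR_exprn ?invr_ge0// -powRM ?exprn_ge0 ?invr_ge0//.
apply: powR_le_root => //; first by rewrite mulr_ge0 ?exprn_ge0 ?invr_ge0.
by rewrite exprVn ler_pdivlMr ?exprn_gt0// mulrC.
Qed.

(** The limit is taken almost everywhere, and Fatou's lemma carries the rate over
    to it, in the same way for [p < 1] and [p >= 1]. *)
Lemma fast_cauchy_cvg (F : nat -> T -> R) (W : R) :
  (forall k, measurable_fun U (F k)) ->
  (forall i j, (i <= j)%N ->
    (\int[mu]_(x in U) (`|F i x - F j x| `^ p)%:E <= (W / 4 ^+ i)%:E)%E) ->
  exists2 f : T -> R, measurable_fun U f &
    forall i, (\int[mu]_(x in U) (`|F i x - f x| `^ p)%:E <= (W / 4 ^+ i)%:E)%E.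
Proof.
move=> mF FW.
(* An upper limit is measurable everywhere and equals the limit where it exists. *)
pose f x := fine (limn_esup (fun k => (F k x)%:E)).
have mf : measurable_fun U f.
  apply: (measurableT_comp (fine_measurable measurableT)) => //.
  by apply: measurable_fun_limn_esup => k; exact/measurable_EFinP.
have aef : {ae mu, forall x, U x -> F ^~ x @ \oo --> f x}.
  have : {ae mu, forall x, U x -> cvgn (F ^~ x)}.
    apply: (fast_cauchy_ae_cvg mF) => k.
    by under eq_integral do rewrite distrC; exact: FW.
  apply: filterS => x Fx Ux; have /(_ Ux) := Fx.
  rewrite /f => /cvg_ex[l Fl].
  have : (F k x)%:E @[k --> \oo] --> l%:E.
    by apply: cvg_EFin => //; exact: nearW.
  by move=> /cvg_limn_einf_sup[_ ->].
exists f => // i.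
have mg j : measurable_fun U (fun x => (`|F i x - F j x| `^ p)%:E).
  by apply: (measurable_powR_norm (g := F i \- F j)); exact: measurable_funB.
pose g j x : \bar R := (`|F i x - F (j + i)%N x| `^ p)%:E.
have g0 j x : U x -> (0 <= g j x)%E by rewrite lee_fin powR_ge0.
apply: (@le_trans _ _ (\int[mu]_(x in U) limn_einf (g ^~ x))%E).
  apply: ae_ge0_le_integral => //.
  - by apply: (measurable_powR_norm (g := F i \- f)); exact: measurable_funB.
  - move=> x Ux; rewrite limn_einf_lim; apply: lime_ge; first exact: is_cvg_einfs.
    by apply: nearW => n; apply: le_ereal_inf_tmp => _ [k _ <-]; exact: g0.
  - rewrite (_ : (fun _ => _) = (fun x => - limn_esup (fun j => - g j x))%E).
      apply: measurableT_comp => //; apply: measurable_fun_limn_esup => j.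
      by apply: (measurableT_comp (f := -%E) (g := g j)) => //; exact: mg.
    by apply/funext => x; rewrite -limn_einfN; congr limn_einf; apply/funext => j;
       rewrite /comp oppeK.
  - apply: filterS aef => x Fx Ux.
    have Fx' : F i x - F (j + i)%N x @[j --> \oo] --> F i x - f x.
      apply: cvgB; first exact: cvg_cst.
      by have /(_ Ux) := Fx; rewrite -(cvg_shiftn i).
    have : g j x @[j --> \oo] --> (`|F i x - f x| `^ p)%:E.
      by apply: cvg_EFin; [exact: nearW|exact: cvg_powR_norm].
    by move=> /cvg_limn_einf_sup[-> _].
apply: le_trans (fatou mu mU _ _) _ => //; first by move=> j; exact: mg.
rewrite limn_einf_lim; apply: lime_le; first exact: is_cvg_einfs.
apply: nearW => n; apply: le_trans (FW i (n + i)%N (leq_addl _ _)).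
by apply: ereal_inf_lbound; exists n => //=.
Qed.

End completeness.

(** * Sobolev energy in a metric measure space *)

Section energy.
Context {R : realType} {disp : measure_display} {T : measurableType disp}.
Variables (mu : {sigma_finite_measure set T -> \bar R}) (dist : T -> T -> R).
Variables (U : set T) (s h q : R).
Implicit Types (f : T -> R) (x y z : T).

Definition power_int p f : \bar R := (\int[mu]_(x in U) (`|f x| `^ p)%:E)%E.

(** The inner integral of the Gagliardo seminorm of order [h]. It plays the role
    of the [q]-th power of a Hajlasz gradient of [f]. *)
Definition energy f x : \bar R :=
  (\int[mu]_(y in U) (`|f x - f y| `^ q / dist x y `^ (s + h * q))%:E)%E.

Hypothesis mU : measurable U.
Hypothesis dist_meas : measurable_fun setT (fun z : T * T => dist z.1 z.2).

Lemma energy_ge0 f x : (0 <= energy f x)%E.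
Proof. by apply: integral_ge0 => y _; rewrite lee_fin divr_ge0 ?powR_ge0. Qed.

Lemma power_int_ge0 p f : (0 <= power_int p f)%E.
Proof. by apply: integral_ge0 => y _; rewrite lee_fin powR_ge0. Qed.

Lemma measurable_kernel (d' : measure_display) (T' : measurableType d')
    (D : set T') (g : T' -> R) (e : T' -> R) p :
  measurable_fun D g -> measurable_fun D e ->
  measurable_fun D (fun t => (`|g t| `^ q / e t `^ p)%:E).
Proof.
move=> mg me; apply/measurable_EFinP.
apply: measurable_funM.
  apply: (measurableT_comp (f := @powR R ^~ q) (g := fun t => `|g t|)) => //.
  exact: measurableT_comp.
have -> : (fun t => (e t `^ p)^-1) = (fun t => e t `^ (- p)).
  by apply/funext => t; rewrite powRN.
exact: (measurableT_comp (f := @powR R ^~ (- p))).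
Qed.

Lemma measurable_distl x D : measurable_fun D (dist x).
Proof.
apply: measurable_funTS.
exact: (measurableT_comp dist_meas (measurable_pair1 x)).
Qed.

(** Tonelli's theorem concerns functions on the whole product space, so [f] is
    first extended by a constant outside [U]. *)
Lemma measurable_energy f : measurable_fun U f -> measurable_fun U (energy f).
Proof.
move=> mf.
have mfU : measurable_fun setT (f \_ U) by exact/(measurable_restrictT _ _).1.
pose k (z : T * T) : \bar R :=
  ((fun z : T * T => (`|(f \_ U) z.1 - (f \_ U) z.2| `^ q /
   dist z.1 z.2 `^ (s + h * q))%:E) \_ (setT `*` U)) z.
have mk : measurable_fun setT k.
  apply/(measurable_restrictT _ _).1; first exact: measurableX.
  apply: measurable_funTS; apply: measurable_kernel => //.
  by apply: measurable_funB; exact: measurableT_comp.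
have k0 w : (0 <= k w)%E.
  by rewrite /k patchE; case: ifP => // _; rewrite lee_fin divr_ge0 ?powR_ge0.
have := measurable_fun_fubini_tonelli_F (m2 := mu) _ mk k0.
move=> /(measurable_funTS (D := U)); apply: eq_measurable_fun => x.
rewrite inE => Ux; rewrite /fubini_F /energy [RHS]integral_mkcond.
apply: eq_integral => y _; rewrite /k /= !patchE.
have [Uy|Uy] := boolP (y \in U).
  have -> : (x, y) \in [set: T] `*` U by rewrite inE; split => //; exact: set_mem.
  by rewrite /= mem_set.
by rewrite memNset//= => -[_ /= /mem_set]; rewrite (negbTE Uy).
Qed.

Hypotheses (q0 : 0 < q) (h0 : 0 < h) (s0 : 0 < s).
Hypotheses (dist_ge0 : forall x y, 0 <= dist x y)
  (dist_eq0 : forall x y, dist x y = 0 -> x = y)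
  (dist_tri : forall x y z, dist x z <= dist x y + dist y z).
Variables (c r0 : R).
Hypotheses (c0 : 0 < c) (r0_gt0 : 0 < r0).
Hypothesis density : forall x (r : R), U x -> 0 < r <= r0 ->
  ((c * r `^ s)%:E <= mu (U `&` [set y | (dist x y < r)%R]))%E.

Lemma measurable_ballU x r : measurable (U `&` [set y | dist x y < r]).
Proof.
have -> : [set y | dist x y < r] = dist x @^-1` `]-oo, r[.
  by apply/seteqP; split => y /=; rewrite in_itv.
by apply: (measurable_distl x mU) => //; exact: measurable_itv.
Qed.

(** Inside a ball of radius [r] the kernel is at least [r^-(s + h q)]. At
    [z = x], where the kernel is [0 / 0 = 0], both sides vanish. *)
Lemma energy_ball f x (A : set T) r : measurable_fun U f ->
  measurable A -> A `<=` U -> (forall z, A z -> dist x z <= r) ->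
  (\int[mu]_(z in A) (`|f x - f z| `^ q)%:E <=
    (r `^ (s + h * q))%:E * energy f x)%E.
Proof.
move=> mf mA AU Ar.
have mk : measurable_fun U
    (fun z => (`|f x - f z| `^ q / dist x z `^ (s + h * q))%:E).
  by apply: measurable_kernel; [exact: measurable_funB|exact: measurable_distl].
rewrite /energy -ge0_integralZl//; last 2 first.
- by move=> z _; rewrite lee_fin divr_ge0// powR_ge0.
- by rewrite lee_fin powR_ge0.
apply: (@le_trans _ _ (\int[mu]_(z in A) ((r `^ (s + h * q))%:E *
    (`|f x - f z| `^ q / dist x z `^ (s + h * q))%:E))%E); last first.
  apply: ge0_subset_integral => //; first exact: measurable_funeM.
  by move=> z _; rewrite -EFinM lee_fin mulr_ge0// ?divr_ge0// powR_ge0.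
apply: ge0_le_integral => //.
- apply: measurable_powR_norm; apply: measurable_funB => //.
  exact: measurable_funS mf.
- by apply: measurable_funeM; exact: measurable_funS mk.
move=> z Az; rewrite -EFinM lee_fin.
have [/dist_eq0 ->|dxz] := eqVneq (dist x z) 0.
  by rewrite subrr normr0 powR0 ?gt_eqF// mulr_ge0// ?mulr_ge0// ?invr_ge0 powR_ge0.
have dxz0 : 0 < dist x z by rewrite lt_neqAle eq_sym dxz dist_ge0.
rewrite mulrCA ler_peMr ?powR_ge0// ler_pdivlMr ?powR_gt0// mul1r.
have := Ar _ Az => dr.
apply: ge0_ler_powR => //; rewrite ?nnegrE//; last exact: le_trans dr.
by rewrite addr_ge0 ?mulr_ge0// ltW.
Qed.

(** Both pointwise estimates below come from averaging a two-term bound over a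
    piece of a ball. *)
Lemma quasi_average (A : set T) (v : R) (u w : T -> R) : 0 <= v ->
  measurable A -> measurable_fun A u -> measurable_fun A w ->
  (forall z, A z -> 0 <= u z) -> (forall z, A z -> 0 <= w z) ->
  (forall z, A z -> v <= 2 `^ q * (u z + w z)) ->
  (v%:E * mu A <= (2 `^ q)%:E *
    (\int[mu]_(z in A) (u z)%:E + \int[mu]_(z in A) (w z)%:E))%E.
Proof.
move=> v0 mA mu_ mw u0 w0 vuw.
have mu1 : measurable_fun A (EFin \o u) by exact/measurable_EFinP.
have mw1 : measurable_fun A (EFin \o w) by exact/measurable_EFinP.
rewrite -ge0_integralD// -ge0_integralZl//; last 2 first.
- exact: emeasurable_funD.
- by move=> z Az; rewrite adde_ge0// lee_fin ?u0 ?w0.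
rewrite -integral_cst//; apply: ge0_le_integral => //=.
by apply: measurable_funeM; exact: emeasurable_funD.
Qed.

(** The Hajlasz-type inequality: average over [z] in [U cap B(y, r)], a set of
    measure at least [c r^s] which lies in both [B(y, r)] and [B(x, 2 r)]. The
    factor [r^(s + h q) / r^s] leaves [r^(h q)]. *)
Lemma energy_hoelder f x y r a b : measurable_fun U f -> U x -> U y ->
  0 < r <= r0 -> dist x y < r ->
  (energy f x <= a%:E)%E -> (energy f y <= b%:E)%E ->
  `|f x - f y| `^ q <=
    2 `^ q * 2 `^ (s + h * q) / c * r `^ (h * q) * (a + b).
Proof.
move=> mf Ux Uy r0r dxy xa yb; have /andP[rgt0 _] := r0r.
pose A := U `&` [set z | dist y z < r].
have mA : measurable A by exact: measurable_ballU.
have mfA : measurable_fun A f by apply: measurable_funS mf => // z [].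
have a0 : 0 <= a by rewrite -lee_fin (le_trans _ xa)// energy_ge0.
have b0 : 0 <= b by rewrite -lee_fin (le_trans _ yb)// energy_ge0.
have mB z : measurable_fun A (fun t => `|f z - f t| `^ q).
  by apply/measurable_EFinP/measurable_powR_norm; exact: measurable_funB.
have avg : ((`|f x - f y| `^ q)%:E * mu A <= (2 `^ q)%:E *
    (\int[mu]_(z in A) (`|f x - f z| `^ q)%:E +
     \int[mu]_(z in A) (`|f y - f z| `^ q)%:E))%E.
  apply: (quasi_average _ mA (mB x) (mB y)) => // z _.
  by rewrite (distrC (f y)); exact/powR_dist_le/ltW.
have shq0 : 0 <= s + h * q by rewrite addr_ge0 ?mulr_ge0// ltW.
have fromx : (\int[mu]_(z in A) (`|f x - f z| `^ q)%:E <=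
    ((2 * r) `^ (s + h * q) * a)%:E)%E.
  apply: le_trans (energy_ball (r := 2 * r) mf mA _ _) _ => //.
  - by move=> z [].
  - move=> z [_ /= yz]; apply: le_trans (dist_tri _ y _) _.
    by rewrite mulr_natl mulr2n lerD// ltW.
  - by rewrite EFinM lee_wpmul2l// lee_fin powR_ge0.
have fromy : (\int[mu]_(z in A) (`|f y - f z| `^ q)%:E <=
    ((2 * r) `^ (s + h * q) * b)%:E)%E.
  apply: le_trans (energy_ball (r := 2 * r) mf mA _ _) _ => //.
  - by move=> z [].
  - by move=> z [_ /= yz]; lra.
  - by rewrite EFinM lee_wpmul2l// lee_fin powR_ge0.
have : ((`|f x - f y| `^ q)%:E * (c * r `^ s)%:E <=
    (2 `^ q)%:E * (((2 * r) `^ (s + h * q) * a)%:E +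
    ((2 * r) `^ (s + h * q) * b)%:E))%E.
  apply: le_trans (le_trans avg _).
    by rewrite lee_wpmul2l ?lee_fin ?powR_ge0//; exact: density.
  by rewrite lee_wpmul2l ?lee_fin ?powR_ge0// leeD.
rewrite -!EFinD -!EFinM lee_fin -ler_pdivlMr; last by rewrite mulr_gt0// powR_gt0.
move=> /le_trans; apply; rewrite le_eqVlt; apply/orP; left; apply/eqP.
have r0' : r `^ s != 0 by rewrite gt_eqF// powR_gt0.
rewrite powRM// ?(ltW rgt0)// [r `^ (s + _)]powRD; last first.
  by apply/implyP => _; rewrite gt_eqF.
by field; rewrite r0' gt_eqF.
Qed.

(** The starting point of the chain argument: compare [f x] with the values of
    [f] on a ball of the fixed radius [r0], where the [L^q] norm controls them. *)
Lemma energy_average f x a m : measurable_fun U f -> U x ->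
  (energy f x <= a%:E)%E -> (power_int q f <= m%:E)%E ->
  `|f x| `^ q <= 2 `^ q * (r0 `^ (s + h * q) + 1) / (c * r0 `^ s) * (a + m).
Proof.
move=> mf Ux xa fm.
pose A := U `&` [set z | dist x z < r0].
have mA : measurable A by exact: measurable_ballU.
have mfA : measurable_fun A f by apply: measurable_funS mf => // z [].
have a0 : 0 <= a by rewrite -lee_fin (le_trans _ xa)// energy_ge0.
have m0 : 0 <= m by rewrite -lee_fin (le_trans _ fm)// power_int_ge0.
have mB1 : measurable_fun A (fun t => `|f x - f t| `^ q).
  by apply/measurable_EFinP/measurable_powR_norm; exact: measurable_funB.
have mB2 : measurable_fun A (fun t => `|f t| `^ q).
  by apply/measurable_EFinP/measurable_powR_norm.
have avg : ((`|f x| `^ q)%:E * mu A <= (2 `^ q)%:E *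
    (\int[mu]_(z in A) (`|f x - f z| `^ q)%:E +
     \int[mu]_(z in A) (`|f z| `^ q)%:E))%E.
  apply: (quasi_average _ mA mB1 mB2) => // z _.
  by have := powR_dist_le (f x) 0 (f z) (ltW q0); rewrite !subr0.
have avg1 : (\int[mu]_(z in A) (`|f x - f z| `^ q)%:E <=
    (r0 `^ (s + h * q) * a)%:E)%E.
  apply: le_trans (energy_ball (r := r0) mf mA _ _) _ => //.
  - by move=> z [].
  - by move=> z [_ /ltW].
  - by rewrite EFinM lee_wpmul2l// lee_fin powR_ge0.
have avg2 : (\int[mu]_(z in A) (`|f z| `^ q)%:E <= m%:E)%E.
  apply: le_trans fm; apply: ge0_subset_integral => //.
  - exact: measurable_powR_norm.
  - by move=> z [].
have : ((`|f x| `^ q)%:E * (c * r0 `^ s)%:E <=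
    (2 `^ q)%:E * ((r0 `^ (s + h * q) * a)%:E + m%:E))%E.
  apply: le_trans (le_trans avg _).
    by rewrite lee_wpmul2l ?lee_fin ?powR_ge0// density// r0_gt0/=.
  by rewrite lee_wpmul2l ?lee_fin ?powR_ge0//; exact: leeD avg1 avg2.
rewrite -!EFinD -!EFinM lee_fin -ler_pdivlMr; last by rewrite mulr_gt0// powR_gt0.
move=> /le_trans; apply; rewrite [leRHS]mulrAC ler_wpM2r//.
  by rewrite invr_ge0 mulr_ge0// ?powR_ge0// ltW.
rewrite -mulrA ler_wpM2l ?powR_ge0// mulrDl mul1r.
have := powR_ge0 r0 (s + h * q); set k := _ `^ _ => k0.
by have := mulr_ge0 k0 m0; lra.
Qed.

(** If the energy exceeded [a] on all of [U cap B(x, r)], its integral would be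
    at least [a c r^s > m]. *)
Lemma energy_chebyshev f x r a m : measurable_fun U f -> U x -> 0 < r <= r0 ->
  0 <= a -> m < a * (c * r `^ s) ->
  (\int[mu]_(z in U) energy f z <= m%:E)%E ->
  exists2 y, U y /\ dist x y < r & (energy f y <= a%:E)%E.
Proof.
move=> mf Ux r0r a0 ma Em; apply: contrapT => noy.
pose A := U `&` [set z | dist x z < r].
have mA : measurable A by exact: measurable_ballU.
have mE := measurable_energy mf.
suff : ((a * (c * r `^ s))%:E <= m%:E)%E by rewrite lee_fin leNgt ma.
apply: le_trans (le_trans _ Em).
  by rewrite EFinM; apply: lee_wpmul2l (density Ux r0r); rewrite lee_fin.
apply: (@le_trans _ _ (\int[mu]_(z in A) energy f z)%E); last first.
  by apply: ge0_subset_integral => // [z _|z []//]; exact: energy_ge0.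
rewrite -integral_cst//; apply: ge0_le_integral => //.
- by apply: measurable_funS mE => // z [].
move=> z [Uz xz] /=; rewrite leNgt; apply/negP => /ltW za.
by apply: noy; exists z.
Qed.

Definition sobolev_ball m f :=
  [/\ measurable_fun U f, (power_int q f <= m%:E)%E &
      (\int[mu]_(z in U) energy f z <= m%:E)%E].

Hypothesis hqs : h * q < s.
(** The reciprocal of the critical exponent [s q / (s - h q)]. *)
Let b := (1 - h * q / s) / q.

Let b_gt0 : 0 < b.
Proof. by rewrite divr_gt0// subr_gt0 ltr_pdivrMr// mul1r. Qed.

(** One step of the chain, from energy [2 a] down to energy [a]. *)
Lemma energy_growth_step m f x a : 0 < m -> 0 < a ->
  2 * m / (c * r0 `^ s) <= a -> sobolev_ball m f -> U x ->
  (energy f x <= (2 * a)%:E)%E ->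
  exists y, [/\ U y, (energy f y <= a%:E)%E &
    `|f x - f y| <= (3 * (2 `^ q * 2 `^ (s + h * q) / c) *
      (2 * m / c) `^ (h * q / s)) `^ q^-1 * a `^ b].
Proof.
move=> m0 a0 ma [mf _ Em] Ux xa.
(* The radius at which c r^s is twice m / a, the Chebyshev bound for G > a. *)
pose r := (2 * m / c / a) `^ s^-1.
have mc0 : 0 < 2 * m / c by rewrite divr_gt0// mulr_gt0.
have mca : 0 < 2 * m / c / a by rewrite divr_gt0.
have r_gt0 : 0 < r by rewrite powR_gt0.
have rs : r `^ s = 2 * m / c / a.
  by rewrite /r -powRrM mulVf ?gt_eqF// powRr1// ltW.
have rr0 : r <= r0.
  rewrite -[leRHS](powRr1 (ltW r0_gt0)) -(mulfV (lt0r_neq0 s0)) powRrM.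
  apply: ge0_ler_powR; rewrite ?nnegrE ?powR_ge0 ?invr_ge0 ?(ltW s0) ?(ltW mca)//.
  by move: ma; rewrite !ler_pdivrMr ?mulr_gt0 ?powR_gt0//; lra.
have [] := @energy_chebyshev f x r a m mf Ux _ (ltW a0) _ Em.
- by rewrite r_gt0.
- rewrite rs (_ : a * _ = 2 * m); first lra.
  by field; rewrite !gt_eqF.
move=> y [Uy xy] ya; exists y; split => //.
have hq0 : 0 < h * q by rewrite mulr_gt0.
have rhq : r `^ (h * q) = (2 * m / c) `^ (h * q / s) * a `^ (- (h * q / s)).
  rewrite /r -powRrM [s^-1 * _]mulrC powRM ?(ltW mc0) ?invr_ge0 ?(ltW a0)//.
  by rewrite -(powR_inv1 (ltW a0)) -powRrM mulN1r.
have -> : a `^ b = (a * a `^ (- (h * q / s))) `^ q^-1.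
  rewrite /b powRrM; congr (_ `^ _); rewrite powRD ?powRr1 ?(ltW a0)//.
  by apply/implyP => _; rewrite gt_eqF.
rewrite -powRM ?mulr_ge0 ?powR_ge0 ?invr_ge0 ?(ltW c0) ?(ltW a0)//.
apply: powR_le_root; rewrite ?mulr_ge0 ?powR_ge0 ?invr_ge0 ?(ltW c0) ?(ltW a0)//.
have := energy_hoelder mf Ux Uy _ xy xa ya; rewrite r_gt0 rr0 => /(_ isT).
move=> /le_trans; apply; rewrite rhq le_eqVlt; apply/orP; left; apply/eqP.
by ring.
Qed.

(** The steps of the chain form a geometric series of ratio [2^b > 1], so that
    the last one dominates. *)
Lemma energy_growth_dyadic m : 0 < m -> exists L D, [/\ 1 <= L, 0 <= D &
  forall f, sobolev_ball m f -> forall k x, U x ->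
    (energy f x <= (L * 2 ^+ k)%:E)%E -> `|f x| <= D * (2 ^+ k) `^ b].
Proof.
move=> m0.
pose L := Num.max 1 (2 * m / (c * r0 `^ s)).
have L1 : 1 <= L by rewrite le_max lexx.
have L0 : 0 < L by lra.
pose E := (3 * (2 `^ q * 2 `^ (s + h * q) / c) *
  (2 * m / c) `^ (h * q / s)) `^ q^-1 * L `^ b.
pose K := (2 `^ q * (r0 `^ (s + h * q) + 1) / (c * r0 `^ s) * (L + m)) `^ q^-1.
pose B : R := 2 `^ b.
have B1 : 1 < B by apply: powR_gt1 => //; lra.
have E0 : 0 <= E by rewrite mulr_ge0 ?powR_ge0.
(* K bounds f at the bottom level; the second term makes E + D <= D B, which is
   what the induction step consumes. *)
pose D := K + E / (B - 1).
have K0 : 0 <= K by rewrite powR_ge0.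
have EB0 : 0 <= E / (B - 1) by rewrite divr_ge0// subr_ge0 ltW.
have ED : E + D <= D * B.
  rewrite -lerBrDr -{2}[D]mulr1 -mulrBr mulrDl mulfVK; last by rewrite subr_eq0 gt_eqF.
  by rewrite lerDr mulr_ge0// subr_ge0 ltW.
exists L, D; split => //; first by rewrite addr_ge0.
move=> f fm; elim=> [|k IH] x Ux.
  rewrite expr0 mulr1 powR1 mulr1 => xL; case: fm => mf fm _.
  apply: (@le_trans _ _ K); last by rewrite lerDl.
  apply: powR_le_root => //.
    rewrite !mulr_ge0 ?invr_ge0 ?mulr_ge0 ?addr_ge0 ?powR_ge0 ?(ltW c0)//; lra.
  exact: energy_average.
have k0 : 0 < 2 ^+ k :> R by rewrite exprn_gt0.
rewrite exprS mulrCA => xk.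
have [||y [Uy yk xy]] := energy_growth_step m0 _ _ fm Ux xk.
- by rewrite mulr_gt0.
- apply: (@le_trans _ _ L); first by rewrite le_max lexx orbT.
  by rewrite ler_peMr ?(ltW L0)// exprn_ege1//; lra.
have := IH y Uy yk; move: xy.
rewrite [(L * _) `^ b]powRM ?(ltW L0) ?(ltW k0)// mulrA -/E.
rewrite [(2 * _) `^ b]powRM ?(ltW k0)//.
set Bk := (2 ^+ k) `^ b => xy fy.
have Bk0 : 0 <= Bk by rewrite powR_ge0.
rewrite -/B mulrA; apply: (@le_trans _ _ ((E + D) * Bk)); last exact: ler_wpM2r.
rewrite mulrDl -[f x](subrK (f y)) (le_trans (ler_normD _ _))// lerD//.
Qed.

(** With [p = 1 / b], the critical exponent, this bounds [|f|^p] by a multiple of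
    the integrable function [1 + energy f]. *)
Lemma energy_growth m p : 0 < m -> 0 <= p -> exists2 D, 0 <= D &
  forall f, sobolev_ball m f -> forall x a, U x -> 0 <= a ->
    (energy f x <= a%:E)%E -> `|f x| `^ p <= D * (1 + a) `^ (b * p).
Proof.
move=> m0 p0; have [L [D [L1 D0 LD]]] := energy_growth_dyadic m0.
exists ((D * 2 `^ b) `^ p); first exact: powR_ge0.
move=> f fm x a Ux a0 xa.
have [|k /andP[ak ka]] := @power2_bounds R (1 + a); first lra.
have fx : `|f x| <= D * 2 `^ b * (1 + a) `^ b.
  apply: le_trans (LD f fm k x Ux _) _.
    apply: le_trans xa _; rewrite lee_fin (@le_trans _ _ (2 ^+ k))//; first lra.
    by rewrite ler_peMl// exprn_ge0.
  rewrite -mulrA -powRM//; last lra.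
  rewrite ler_wpM2l// ge0_ler_powR// ?nnegrE ?exprn_ge0 ?(ltW b_gt0)//; lra.
rewrite [(1 + a) `^ _]powRrM -powRM ?mulr_ge0 ?powR_ge0//.
by rewrite ge0_ler_powR// ?nnegrE// ?mulr_ge0 ?powR_ge0.
Qed.

Hypothesis totally_bounded : forall e : R, 0 < e ->
  exists (I : finType) (B : I -> set T), (forall x, U x -> exists i, B i x) /\
    forall i x y, B i x -> B i y -> dist x y < e.

(** An Arzela-Ascoli argument whose domain, the sublevel of the energy, depends
    on the function: in each small cell of [U], a function is sampled at some
    point of its own sublevel, if there is one. *)
Lemma energy_sublevel_coloring m K A e : 0 < e -> 1 <= K ->
  (forall f, sobolev_ball m f -> forall x, U x -> (energy f x <= K%:E)%E ->
    `|f x| <= A) ->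
  exists (C : finType) (col : (T -> R) -> C), forall f g,
    sobolev_ball m f -> sobolev_ball m g -> col f = col g ->
    forall x, U x -> (energy f x <= K%:E)%E -> (energy g x <= K%:E)%E ->
      `|f x - g x| <= e.
Proof.
move=> e0 K1 fA.
have hq0 : 0 < h * q by rewrite mulr_gt0.
have e3 : 0 < e / 3 by rewrite divr_gt0.
pose c1 := 2 `^ q * 2 `^ (s + h * q) / c * (K + K).
have c1_gt0 : 0 < c1.
  by rewrite !mulr_gt0 ?invr_gt0 ?powR_gt0//; lra.
pose d := Num.min r0 (((e / 3) `^ q / c1) `^ (h * q)^-1).
have d0 : 0 < d by rewrite lt_min r0_gt0 powR_gt0// divr_gt0 ?powR_gt0.
have dr0 : 0 < d <= r0 by rewrite d0 ge_min lexx.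
have osc f x y : sobolev_ball m f -> U x -> U y -> dist x y < d ->
    (energy f x <= K%:E)%E -> (energy f y <= K%:E)%E -> `|f x - f y| <= e / 3.
  move=> [mf _ _] Ux Uy xy xK yK.
  apply: (powR_le_cancel q0) => //; first exact: ltW.
  apply: le_trans (energy_hoelder mf Ux Uy dr0 xy xK yK) _.
  rewrite mulrAC -/c1 mulrC -ler_pdivlMr//.
  apply: root_powR_le; rewrite ?(ltW d0) ?divr_ge0 ?powR_ge0 ?(ltW c1_gt0)//.
  by rewrite ge_min lexx orbT.
have [I [B [UB Bd]]] := totally_bounded d0.
have [M [code codeP]] := quantization A e3.
(* The value 0 is used when the cell misses the sublevel. *)
pose sample f i := xget 0 (f @` (U `&` B i `&` [set x | (energy f x <= K%:E)%E])).
exists {ffun I -> 'I_M.+1}, (fun f => [ffun i => code (sample f i)]).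
move=> f g fm gm fg x Ux fx gx.
have [i Bix] := UB x Ux.
have sampleP k : sobolev_ball m k -> (energy k x <= K%:E)%E ->
    `|k x - sample k i| <= e / 3 /\ `|sample k i| <= A.
  move=> km kx; rewrite /sample; have [|y [[Uy Biy] yK] <-] := @xgetPex R 0
      (k @` (U `&` B i `&` [set x | (energy k x <= K%:E)%E])).
    by exists (k x), x.
  by split; [apply: osc => //; exact: (Bd i)|exact: fA].
have [fxs fsA] := sampleP f fm fx; have [gxs gsA] := sampleP g gm gx.
have := codeP _ _ fsA gsA.
move/ffunP : fg => /(_ i); rewrite !ffunE => -> /(_ erefl).
move: fxs gxs; rewrite !ler_norml => /andP[? ?] /andP[? ?] /andP[? ?].
by apply/andP; split; lra.
Qed.

(** The bound holds at every point of [U]: where an energy is infinite the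
    right-hand side is infinite, where one is large [energy_growth] and the
    subcritical exponent apply, and elsewhere both functions are in the sublevel
    on which the colouring controls their difference. *)
Lemma energy_coloring m p e : 0 < m -> 0 < p -> b * p < 1 -> 0 < e ->
  exists (C : finType) (col : (T -> R) -> C), forall f g,
    sobolev_ball m f -> sobolev_ball m g -> col f = col g ->
    forall x, U x ->
    ((`|f x - g x| `^ p)%:E <= e%:E * (1 + energy f x + energy g x))%E.
Proof.
move=> m0 p0 bp1 e0.
have [D D0 growth] := energy_growth m0 (ltW p0).
have [|K K1 absorb] := @sublinear_absorb R (2 `^ p * (D + D)) (b * p) e _ bp1 e0.
  by rewrite mulr_ge0 ?powR_ge0// addr_ge0.
have [D1 D10 growth1] := energy_growth m0 ler01.
have bp0 : 0 <= b * p by rewrite ltW// mulr_gt0.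
have [|f fm x Ux xK|C [col colP]] := @energy_sublevel_coloring m K
    (D1 * (1 + K) `^ (b * 1)) (e `^ p^-1) _ K1.
- by rewrite powR_gt0.
- by have := growth1 f fm x K Ux _ xK; rewrite powRr1//; apply; lra.
exists C, col => f g fm gm fg x Ux.
have := energy_ge0 f x; have := energy_ge0 g x.
move fxE : (energy f x) => u; move gxE : (energy g x) => v.
move: u v fxE gxE => [u| |] [v| |] // fxE gxE; last 3 first.
- by move=> _ _; rewrite addey// gt0_muley ?lte_fin// leey.
- by move=> _ _; rewrite addey// addye// gt0_muley ?lte_fin// leey.
- by move=> _ _; rewrite addey// gt0_muley ?lte_fin// leey.
rewrite !lee_fin => v0 u0.
have fxu : (energy f x <= u%:E)%E by rewrite fxE.
have gxv : (energy g x <= v%:E)%E by rewrite gxE.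
(* Below K both energies are in the sublevel; above K the growth bound is absorbed. *)
have [Kuv|uvK] := leP K (1 + u + v); last first.
  apply: (@le_trans _ _ e); last by rewrite ler_peMr ?(ltW e0)//; lra.
  apply: root_powR_le => //; first exact: ltW.
  by apply: colP => //; rewrite (fxE, gxE) lee_fin; lra.
apply: le_trans (absorb _ Kuv).
have := powR_dist_le (f x) (g x) 0 (ltW p0); rewrite subr0 sub0r normrN.
move=> /le_trans; apply; rewrite -mulrA ler_wpM2l ?powR_ge0// mulrDl lerD//.
- apply: le_trans (growth f fm x u Ux u0 fxu) _.
  by rewrite ler_wpM2l// ge0_ler_powR// ?nnegrE; lra.
- apply: le_trans (growth g gm x v Ux v0 gxv) _.
  by rewrite ler_wpM2l// ge0_ler_powR// ?nnegrE; lra.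
Qed.

Lemma integral_energy_le m f g e : (mu U < +oo)%E -> 0 <= e ->
  sobolev_ball m f -> sobolev_ball m g ->
  (\int[mu]_(x in U) (e%:E * (1 + energy f x + energy g x)) <=
    (e * (fine (mu U) + m + m))%:E)%E.
Proof.
move=> Ufin e0 [mf _ fm] [mg _ gm].
have mEf := measurable_energy mf; have mEg := measurable_energy mg.
have Ef0 := energy_ge0 f; have Eg0 := energy_ge0 g.
have mD : measurable_fun U (fun x => (1 + energy f x)%E).
  by apply: emeasurable_funD.
have mS : measurable_fun U (fun x => (1 + energy f x + energy g x)%E).
  exact: emeasurable_funD mD mEg.
have S0 x : U x -> (0 <= 1 + energy f x + energy g x)%E.
  by move=> _; rewrite adde_ge0 ?Eg0// adde_ge0 ?Ef0.
have D0 x : U x -> (0 <= 1 + energy f x)%E by move=> _; rewrite adde_ge0 ?Ef0.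
have e0' : (0 <= e%:E)%E by rewrite lee_fin.
rewrite (ge0_integralZl mu mU mS S0 e0').
rewrite EFinM; apply: lee_wpmul2l => //.
rewrite (ge0_integralD mu mU D0 mD (fun x _ => Eg0 x) mEg).
rewrite (ge0_integralD mu mU (fun _ _ => lee01) _ (fun x _ => Ef0 x) mEf)//.
rewrite integral_cst// mul1e !EFinD fineK ?ge0_fin_numE//.
by apply: leeD gm; apply: leeD fm.
Qed.

Theorem sobolev_ball_subcritical m p f : (mu U < +oo)%E -> 0 < m ->
  0 < p -> b * p < 1 -> sobolev_ball m f -> (power_int p f < +oo)%E.
Proof.
move=> Ufin m0 p0 bp1 fm; have [D D0 growth] := energy_growth m0 (ltW p0).
have [mf _ _] := fm; have mEf := measurable_energy mf.
have D10 : 0 <= D + 1 by rewrite addr_ge0.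
have e0 := energy_ge0 f.
apply: (@le_lt_trans _ _
  (\int[mu]_(x in U) ((D + 1)%:E * (1 + energy f x + energy f x)))%E).
  apply: ge0_le_integral => //.
  - exact: measurable_powR_norm.
  - have m1 : measurable_fun U (fun x => (1 + energy f x)%E).
      by apply: emeasurable_funD.
    by apply: measurable_funeM; exact: emeasurable_funD m1 mEf.
  move=> x Ux; have := e0 x; move xE : (energy f x) => u.
  case: u xE => [u| |//] xE u0; last first.
    by rewrite addey// gt0_muley ?leey// lte_fin; lra.
  rewrite lee_fin in u0; rewrite -!EFinD -EFinM lee_fin.
  have xu : (energy f x <= u%:E)%E by rewrite xE.
  apply: le_trans (growth f fm x u Ux u0 xu) _.
  apply: ler_pM; rewrite ?powR_ge0//; first lra.
  apply: (@le_trans _ _ (1 + u)); last lra.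
  by apply: ler1_powR; lra.
by apply: le_lt_trans (integral_energy_le Ufin D10 fm fm) (ltry _).
Qed.

(** The colouring with tolerance [4^-k] is used at the [k]-th stage of the
    diagonal argument, so that the subsequence converges fast enough for
    [fast_cauchy_cvg]. *)
Theorem sobolev_ball_compact m p (f_ : nat -> T -> R) : (mu U < +oo)%E ->
  0 < m -> 0 < p -> b * p < 1 -> (forall j, sobolev_ball m (f_ j)) ->
  exists phi : nat -> nat, {homo phi : i j / (i < j)%N} /\
    exists2 f : T -> R, measurable_fun U f /\ (power_int p f < +oo)%E &
      power_int p (f_ (phi j) \- f) @[j --> \oo] --> 0%E.
Proof.
move=> Ufin m0 p0 bp1 fm.
have e0 k : 0 < (4 ^+ k)^-1 :> R by rewrite invr_gt0 exprn_gt0.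
have colorings k := energy_coloring m0 p0 bp1 (e0 k).
pose C k := projT1 (cid (colorings k)).
pose col k := projT1 (cid (projT2 (cid (colorings k)))).
have colP k := projT2 (cid (projT2 (cid (colorings k)))).
have [phi [phi_incr phi_col]] :=
  diagonal_subsequence (fun k j => col k (f_ j)).
exists phi; split => //.
pose W := fine (mu U) + m + m.
have FW i j : (i <= j)%N ->
    (\int[mu]_(x in U) (`|f_ (phi i) x - f_ (phi j) x| `^ p)%:E <=
      (W / 4 ^+ i)%:E)%E.
  move=> ij; have [mi _ _] := fm (phi i); have [mj _ _] := fm (phi j).
  rewrite mulrC; apply: le_trans (integral_energy_le Ufin (ltW (e0 i))
    (fm (phi i)) (fm (phi j))).
  apply: ge0_le_integral => //.
  - by apply: (measurable_powR_norm (g := f_ (phi i) \- f_ (phi j)));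
      exact: measurable_funB.
  - have mEi := measurable_energy mi; have mEj := measurable_energy mj.
    have m1 : measurable_fun U (fun x => (1 + energy (f_ (phi i)) x)%E).
      by apply: emeasurable_funD.
    by apply: measurable_funeM; exact: emeasurable_funD m1 mEj.
  - move=> x Ux; apply: colP => //; exact: phi_col.
have mF k : measurable_fun U (f_ (phi k)) by case: (fm (phi k)).
have [f mf fW] := fast_cauchy_cvg mU p0 mF FW.
exists f; first split => //.
  have f0 := sobolev_ball_subcritical Ufin m0 p0 bp1 (fm (phi 0%N)).
  pose G x : \bar R := ((2 `^ p)%:E * ((`|f x - f_ (phi 0%N) x| `^ p)%:E +
    (`|f_ (phi 0%N) x| `^ p)%:E))%E.
  have m1 : measurable_fun U (fun x => (`|f x - f_ (phi 0%N) x| `^ p)%:E).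
    apply: (measurable_powR_norm (g := f \- f_ (phi 0%N))).
    exact: measurable_funB.
  have m2 : measurable_fun U (fun x => (`|f_ (phi 0%N) x| `^ p)%:E).
    exact: measurable_powR_norm.
  apply: (@le_lt_trans _ _ (\int[mu]_(x in U) G x)%E).
    apply: ge0_le_integral => //.
    - exact: measurable_powR_norm.
    - by apply: measurable_funeM; exact: emeasurable_funD.
    - move=> x Ux; rewrite /G -EFinD -EFinM lee_fin.
      by have := powR_dist_le (f x) 0 (f_ (phi 0%N) x) (ltW p0); rewrite !subr0.
  have mS : measurable_fun U (fun x => (`|f x - f_ (phi 0%N) x| `^ p)%:E +
      (`|f_ (phi 0%N) x| `^ p)%:E)%E by exact: emeasurable_funD.
  rewrite /G (ge0_integralZl mu mU mS) ?lee_fin ?powR_ge0//; last first.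
    by move=> x _; rewrite -EFinD lee_fin addr_ge0 ?powR_ge0.
  rewrite (ge0_integralD mu mU _ m1 _ m2)//.
  rewrite lte_mul_pinfty ?lee_fin ?powR_ge0//; apply: lte_add_pinfty f0.
  apply: le_lt_trans (le_lt_trans (fW 0%N) (ltry _)).
  by under eq_integral do rewrite distrC.
have W0 : (fun j => (W * (4^-1) ^+ j)%:E) @ \oo --> 0%E.
  apply: cvg_EFin; first exact: nearW.
  rewrite -[X in _ --> X](mulr0 W); apply: cvgMl_tmp; apply: cvg_expr.
  by rewrite ger0_norm ?invr_ge0// invf_lt1// ltr1n.
have le0W : \forall j \near \oo, (0 <= power_int p (f_ (phi j) \- f)%R <=
    (W * (4^-1) ^+ j)%:E)%E.
  apply: nearW => j; rewrite power_int_ge0/= exprVn; exact: fW.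
by have := squeeze_cvge le0W (cvg_cst 0%E) W0; exact.
Qed.

End energy.

(** * Lebesgue measure of cubes and measurability of open sets *)

(** The balls of ['rV[R]_n] are those of the sup norm: axis-parallel cubes. All
    volume estimates below are reduced to them, so that rotated regions never
    have to be measured. *)
Section sup_balls.
Context {R : realType}.

Lemma ball_rVE n (a : 'rV[R]_n) r : 0 < r ->
  ball a r = [set v : 'rV[R]_n | forall i, `|a ord0 i - v ord0 i| < r].
Proof.
move=> r0; apply/seteqP; split=> v /=.
  by move=> [_ av] i; exact: av.
by move=> av; split => // i j; rewrite (ord1 i); exact: av.
Qed.

Lemma measurable_ball_rV n (a : 'rV[R]_n) r : measurable (ball a r).
Proof.
have [r0|r0] := ltP 0 r; last first.
  rewrite (_ : ball a r = set0)// -subset0 => v [r1 _].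
  by move: r0; rewrite leNgt r1.
rewrite ball_rVE//.
have -> : [set v : 'rV[R]_n | forall i, `|a ord0 i - v ord0 i| < r] =
    \bigcap_(i in [set: 'I_n])
      ((fun v : 'rV[R]_n => v ord0 i : measurableTypeR R) @^-1` ball (a ord0 i) r).
  by apply/seteqP; split => v /= av i; [move=> _|]; exact: av.
apply: fin_bigcap_measurable => // i _.
rewrite -[X in measurable X]setTI; apply: measurable_rV_coord => //.
exact: measurable_ball.
Qed.

(** By induction on the dimension: splitting off the first coordinate turns a
    cube into the product of an interval and a cube. *)
Lemma borel_lebesgue_ball n (a : 'rV[R]_n) r : 0 < r ->
  borel_lebesgue_rV R n (ball a r) = ((2 * r) ^+ n)%:E.
Proof.
move=> r0; elim: n a => [|n IH] a.
  rewrite expr0 /= diracE mem_set// ball_rVE//.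
  by move=> /= -[].
rewrite /= /rV_next /pushforward.
pose a' : 'rV[R]_n := rsubmx (a : 'rV[R]_(1 + n)).
have -> : rV_cons @^-1` ball a r =
    (`]a ord0 ord0 - r, a ord0 ord0 + r[%classic : set (measurableTypeR R)) `*` ball a' r.
  rewrite !ball_rVE//; apply/seteqP; split => -[x v] /=.
    move=> H; split; last first.
      move=> i; have := H (rshift 1 i); rewrite /rV_cons /= [X in _ - X]row_mxEr.
      by rewrite mxE.
    have := H (lshift n (ord0 : 'I_1)).
    rewrite /rV_cons /= [X in _ - X]row_mxEl mxE eqxx mulr1n.
    rewrite (_ : lshift n (ord0 : 'I_1) = ord0); last exact: val_inj.
    by rewrite in_itv/= ltr_norml => /andP[? ?]; apply/andP; split; lra.
  rewrite in_itv/= => -[/andP[x1 x2] H] i.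
  have [j ij|j ij] := splitP (i : 'I_(1 + n)).
    have -> : i = lshift n j by exact: val_inj.
    rewrite /rV_cons /= [X in _ - X]row_mxEl mxE (ord1 j) eqxx mulr1n.
    rewrite (_ : lshift n (ord0 : 'I_1) = ord0); last exact: val_inj.
    by rewrite ltr_norml; apply/andP; split; lra.
  have -> : i = rshift 1 j by exact: val_inj.
  by rewrite /rV_cons /= [X in _ - X]row_mxEr; have := H j; rewrite mxE.
rewrite product_measure1E//; last exact: measurable_ball_rV.
rewrite IH exprS EFinM; congr (_ * _)%E.
apply: etrans (lebesgue_measure_itv `]a ord0 ord0 - r, a ord0 ord0 + r[) _.
rewrite /= lte_fin ifT; last lra.
by rewrite -EFinB; congr (_)%:E; lra.
Qed.

(** The sigma-algebra is generated by the coordinates, and an open set is the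
    union of the countably many cubes it contains which have rational centre and
    radius [1 / k.+1]. *)
Lemma open_measurable_rV n (U : set 'rV[R]_n) : open U -> measurable U.
Proof.
move=> oU.
pose B (p : 'rV[rat]_n * nat) : set 'rV[R]_n :=
  ball (map_mx ratr p.1 : 'rV[R]_n) p.2.+1%:R^-1.
pose V (p : 'rV[rat]_n * nat) : set 'rV[R]_n := [set x | B p x /\ B p `<=` U].
have mV p : measurable (V p).
  have [BU|BU] := pselect (B p `<=` U).
    rewrite (_ : V p = B p); first exact: measurable_ball_rV.
    by apply/seteqP; split => x /=; [case|move=> ?; split].
  by rewrite (_ : V p = set0)//; apply/seteqP; split => x //= [].
have -> : U = \bigcup_k (if unpickle k is Some p then V p else set0).
  apply/seteqP; split => [x Ux|x [k _]]; last first.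
    by case: (unpickle k) => [p|//] [Bx BU]; exact: BU.
  have /nbhs_ballP[e /= e0 xU] := open_nbhs_nbhs (conj oU Ux).
  have [k ke] : exists k : nat, k.+1%:R^-1 < e / 2.
    have e20 : 0 < e / 2 by rewrite divr_gt0.
    exists (Num.bound (e / 2)^-1).
    rewrite -[ltRHS]invrK ltf_pV2 ?posrE ?invr_gt0//.
    by rewrite (lt_le_trans (archi_boundP _)) ?invr_ge0 ?ler_nat// ltW.
  have k0 : 0 < k.+1%:R^-1 :> R by rewrite invr_gt0.
  have rat_near i : {q : rat | `|ratr q - x ord0 i| < k.+1%:R^-1 :> R}.
    apply/cid; move: k0; set d := k.+1%:R^-1 => d0.
    have xx : x ord0 i - d < x ord0 i + d by lra.
    have [q] := rat_in_itvoo xx; rewrite in_itv/= => /andP[q1 q2].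
    by exists q; rewrite ltr_norml; apply/andP; split; lra.
  pose p : 'rV[rat]_n * nat := (\row_i projT1 (rat_near i), k).
  have pP i : `|(map_mx ratr p.1 : 'rV[R]_n) ord0 i - x ord0 i| < k.+1%:R^-1.
    by rewrite !mxE; exact: projT2 (rat_near i).
  exists (pickle p) => //; rewrite pickleK; split.
    by rewrite /B ball_rVE.
  move=> v; rewrite /B ball_rVE// => pv; apply: xU; rewrite ball_rVE// => i.
  have := pP i; have := pv i; rewrite -[p.2]/k !ltr_norml.
  move: ke k0; set d := k.+1%:R^-1 => ke k0.
  by move=> /andP[? ?] /andP[? ?]; apply/andP; split; lra.
apply: bigcupT_measurable => k; case: (unpickle k) => [p|]; [exact: mV|exact: measurable0].
Qed.

End sup_balls.

Section lebesgue_space.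
Context {R : realType} {n : nat}.

(** Convertible to [lebesgue_rV], but a constant of its own to which the
    sigma-finite structure required by Tonelli's theorem can be attached. *)
Definition sf_lebesgue : set (lebesgue_space R n) -> \bar R :=
  @completed_measure_extension _ _ _ (borel_lebesgue_rV R n).

HB.instance Definition _ := Measure.on sf_lebesgue.

Let sf_lebesgue_sigma_finite : sigma_finite setT sf_lebesgue.
Proof.
exact: completed_measure_extension_sigma_finite (sigma_finiteT _).
Qed.

HB.instance Definition _ := @Measure_isSigmaFinite.Build _ _ _
  sf_lebesgue sf_lebesgue_sigma_finite.

Lemma measurable_lebesgue_space (A : set 'rV[R]_n) :
  measurable A -> measurable (A : set (lebesgue_space R n)).
Proof. by move=> mA; apply: caratheodory_measurable_mu_ext. Qed.

Lemma lebesgue_rV_borel (A : set 'rV[R]_n) :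
  measurable A -> lebesgue_rV R n A = borel_lebesgue_rV R n A.
Proof. by move=> mA; exact: (measurable_mu_extE (borel_lebesgue_rV R n) mA). Qed.

Lemma measurable_coord_lebesgue (i : 'I_n) :
  measurable_fun setT (fun v : lebesgue_space R n => (v : 'rV[R]_n) ord0 i).
Proof.
move=> _ Y mY; rewrite setTI; apply: measurable_lebesgue_space.
by rewrite -[X in measurable X]setTI; exact: measurable_rV_coord.
Qed.

Lemma measurable_euclidean_dist : measurable_fun setT
  (fun z : lebesgue_space R n * lebesgue_space R n => @euclidean_dist R n z.1 z.2).
Proof.
apply: (measurableT_comp (f := @Num.sqrt R)).
  by apply: continuous_measurable_fun; exact: sqrt_continuous.
apply: measurable_sum => i; apply: measurable_funX; apply: measurable_funB.
- exact: (measurableT_comp (measurable_coord_lebesgue i) measurable_fst).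
- exact: (measurableT_comp (measurable_coord_lebesgue i) measurable_snd).
Qed.

End lebesgue_space.

(** * The Euclidean distance *)

Section euclidean_dist.
Context {R : realType}.

Lemma sum_sqr_ge0 (I : finType) (a : I -> R) : 0 <= \sum_i a i ^+ 2.
Proof. by apply: sumr_ge0 => i _; exact: sqr_ge0. Qed.

Lemma cauchy_schwarz (I : finType) (a b : I -> R) :
  (\sum_i a i * b i) ^+ 2 <= (\sum_i a i ^+ 2) * (\sum_i b i ^+ 2).
Proof.
set A := \sum_i a i ^+ 2; set B := \sum_i b i ^+ 2; set C := \sum_i a i * b i.
have A0 : 0 <= A by exact: sum_sqr_ge0.
have [A_eq0|A_neq0] := eqVneq A 0.
  have a0 i : a i = 0.
    apply/eqP; rewrite -sqrf_eq0; apply/eqP.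
    move/eqP : A_eq0; rewrite psumr_eq0; last by move=> j _; exact: sqr_ge0.
    by move=> /allP /(_ i); rewrite mem_index_enum => /(_ isT) /eqP.
  rewrite /C big1; first by rewrite expr0n/= A_eq0 mul0r.
  by move=> i _; rewrite a0 mul0r.
have A_gt0 : 0 < A by rewrite lt_neqAle eq_sym A_neq0.
(* A b - C a is A times the component of b orthogonal to a. *)
have : 0 <= \sum_i (A * b i - C * a i) ^+ 2 by exact: sum_sqr_ge0.
have -> : \sum_i (A * b i - C * a i) ^+ 2 = A * (A * B - C ^+ 2).
  transitivity (\sum_i (A ^+ 2 * b i ^+ 2 - 2 * A * C * (a i * b i) +
      C ^+ 2 * a i ^+ 2)).
    by apply: eq_bigr => i _; ring.
  rewrite big_split/= sumrB -!mulr_sumr -/A -/B -/C; ring.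
by rewrite pmulr_rge0// subr_ge0.
Qed.

Lemma euclidean_dist_ge0 k (x y : 'rV[R]_k) : 0 <= euclidean_dist x y.
Proof. exact: sqrtr_ge0. Qed.

Lemma euclidean_dist_eq0 k (x y : 'rV[R]_k) : euclidean_dist x y = 0 -> x = y.
Proof.
move=> /eqP; rewrite sqrtr_eq0 => xy; apply/rowP => i; apply/eqP.
rewrite -subr_eq0 -sqrf_eq0 eq_le sqr_ge0 andbT; apply: le_trans xy.
by rewrite (bigD1 i)//= lerDl sumr_ge0// => j _; exact: sqr_ge0.
Qed.

Lemma euclidean_dist_triangle k (x y z : 'rV[R]_k) :
  euclidean_dist x z <= euclidean_dist x y + euclidean_dist y z.
Proof.
rewrite /euclidean_dist.
pose a i := x ord0 i - y ord0 i; pose b i := y ord0 i - z ord0 i.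
pose A := \sum_i a i ^+ 2; pose B := \sum_i b i ^+ 2.
rewrite -/A -/B.
have A0 : 0 <= A by exact: sum_sqr_ge0.
have B0 : 0 <= B by exact: sum_sqr_ge0.
rewrite -ler_sqr ?nnegrE ?addr_ge0 ?sqrtr_ge0// sqr_sqrtr ?sum_sqr_ge0//.
rewrite sqrrD !sqr_sqrtr//.
have -> : \sum_(i < k) (x ord0 i - z ord0 i) ^+ 2 =
    A + (\sum_i a i * b i) *+ 2 + B.
  rewrite -sumrMnl -!big_split; apply: eq_bigr => i _ /=.
  by rewrite /a /b; ring.
rewrite lerD2r lerD2l lerMn2r/= (le_trans (ler_norm _))//.
rewrite -sqrtrM// -sqrtr_sqr ler_sqrt ?mulr_ge0//.
exact: cauchy_schwarz.
Qed.

Lemma coord_le_norm k (v : 'rV[R]_k) i : `|v ord0 i| <= `|v|.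
Proof.
rewrite [leRHS]/Num.norm/= mx_normrE.
by apply: (@le_bigmax _ _ _ 0 (fun ij : 'I_1 * 'I_k => `|v ij.1 ij.2|) (ord0, i)).
Qed.

Lemma norm_le_coord k (v : 'rV[R]_k) a : 0 <= a ->
  (forall i, `|v ord0 i| <= a) -> `|v| <= a.
Proof.
move=> a0 va; rewrite [leLHS]/Num.norm/= mx_normrE; apply/bigmax_leP; split => //.
by move=> [i j] _ /=; rewrite (ord1 i).
Qed.

Lemma euclidean_dist_le_norm k (x y : 'rV[R]_k) :
  euclidean_dist x y <= k%:R * `|x - y|.
Proof.
rewrite /euclidean_dist -[leRHS]ger0_norm ?mulr_ge0// -sqrtr_sqr ler_sqrt ?sqr_ge0//.
apply: (@le_trans _ _ (\sum_(i < k) `|x - y| ^+ 2)).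
  apply: ler_sum => i _; have := coord_le_norm (x - y) i; rewrite !mxE => xy.
  by rewrite -[leLHS]real_normK ?num_real// ler_sqr ?nnegrE.
rewrite sumr_const card_ord -[leLHS]mulr_natl exprMn ler_wpM2r ?sqr_ge0//.
by rewrite -natrX ler_nat expnS expn1; case: (k) => // m; rewrite leq_pmulr.
Qed.

Lemma mulmx_norm_bounded k l (Q : 'M[R]_(k, l)) :
  exists2 K, 1 <= K & forall v : 'rV[R]_k, `|v *m Q| <= K * `|v|.
Proof.
pose S := \sum_i \sum_j `|Q i j|.
have S0 : 0 <= S by apply: sumr_ge0 => i _; exact: sumr_ge0.
exists (1 + S) => [|v]; first by rewrite lerDl.
apply: norm_le_coord => [|j]; first by rewrite mulr_ge0// addr_ge0.
rewrite mxE (le_trans (ler_norm_sum _ _ _))//.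
apply: (@le_trans _ _ (S * `|v|)); last by rewrite ler_wpM2r// lerDr.
rewrite mulr_suml; apply: ler_sum => i _.
rewrite normrM mulrC; apply: ler_pM => //; last exact: coord_le_norm.
by rewrite (bigD1 j)//= lerDl sumr_ge0.
Qed.

End euclidean_dist.

(** * Lipschitz domains contain balls at every scale *)

Section corkscrew.
Context {R : realType} {n : nat}.
Implicit Types (U : set 'rV[R]_n) (x y z : 'rV[R]_n).

(** One constant serves both as the largest scale and as the ratio of the radii:
    the property is then monotone in [e], and a compactness argument makes it
    uniform. *)
Definition corkscrew U e y := U y -> forall t, 0 < t <= e ->
  exists z, ball z (e * t) `<=` ball y t `&` U.

Lemma corkscrew_interior U x : open U -> U x ->
  exists2 d, 0 < d & forall e y, 0 < e <= d -> ball x d y -> corkscrew U e y.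
Proof.
move=> oU Ux.
have /nbhs_ballP[e /= e0 xU] := open_nbhs_nbhs (conj oU Ux).
pose d := Num.min 1 (e / 2).
have d0 : 0 < d by rewrite lt_min ltr01 divr_gt0.
have [d1 de] : d <= 1 /\ d <= e / 2 by split; rewrite ge_min lexx ?orbT.
exists d => // c y /andP[c0 cd] xy Uy t /andP[t0 tc]; exists y => v yv.
have ctt : c * t <= t by rewrite ler_piMl ?(ltW t0)//; lra.
have yv' : ball y t v by apply: le_ball yv.
split => //; apply: xU.
have := ball_triangle xy yv'; apply: le_ball; lra.
Qed.

(** Move from [y] along the vertical direction of the chart. A displacement [u]
    of the new point changes the graph side by at most [L |u|] and the vertical
    coordinate by at most [|u|], up to constants comparing the sup norm before
    and after rotation; so a cube of radius proportional to the vertical move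
    stays above the graph. *)
Lemma corkscrew_boundary U x0 : lipschitz_epigraph_near U x0 ->
  exists2 d, 0 < d & forall e y, 0 < e <= d -> ball x0 d y -> corkscrew U e y.
Proof.
move=> [r [L [Q [i [gamma [r0 QQ gammaL chart]]]]]].
have QtQ : Q^T *m Q = 1%:M by exact: mulmx1C.
have [K1 K11 QK1] := mulmx_norm_bounded Q.
have [K2 K21 QK2] := mulmx_norm_bounded Q^T.
pose M := 1 + `|L| * n%:R.
have M1 : 1 <= M by rewrite lerDl mulr_ge0.
pose a := M * K1.
have a0 : 0 < a by rewrite mulr_gt0//; lra.
pose e : 'rV[R]_n := delta_mx ord0 i *m Q^T.
have eK : `|e| <= K2.
  apply: le_trans (QK2 _) _; rewrite ler_piMr//; first lra.
  apply: norm_le_coord => // j; rewrite mxE.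
  by case: (_ && _); rewrite ?normr1 ?normr0.
have n0 : 0 < n%:R :> R by rewrite ltr0n; exact: leq_ltn_trans (ltn_ord i).
(* The first bound keeps all points in the chart, the second keeps the whole cube
   in the ball of radius t about y. *)
pose d := Num.min (r / (2 * n%:R)) (a * K2 + 1)^-1.
have aK : 0 < a * K2 + 1 by rewrite ltr_wpDl// mulr_ge0 ?(ltW a0)//; lra.
have d0 : 0 < d.
  by rewrite lt_min; apply/andP; split; rewrite ?invr_gt0 ?divr_gt0 ?mulr_gt0.
have dr : n%:R * (d + d) <= r.
  have : d <= r / (2 * n%:R) by rewrite ge_min lexx.
  by rewrite ler_pdivlMr ?mulr_gt0//; lra.
have dK : d * (a * K2 + 1) <= 1.
  by rewrite -ler_pdivlMr// div1r ge_min lexx orbT.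
exists d => // c y /andP[c0 cd] x0y Uy t /andP[t0 tc].
have inchart v : `|v - x0| < d + d -> euclidean_dist v x0 < r.
  move=> vx; apply: le_lt_trans (euclidean_dist_le_norm _ _) _.
  by apply: lt_le_trans dr; rewrite ltr_pM2l.
have yx0 : `|y - x0| < d.
  by move: x0y; rewrite mx_norm_ball /ball_/= distrC.
have /(chart y)/iffLR/(_ Uy) yg : euclidean_dist y x0 < r.
  by apply: inchart; lra.
exists (y + (a * (c * t)) *: e) => v.
rewrite mx_norm_ball /ball_/=; set z := y + _ => zv.
pose u := v - z.
have uct : `|u| < c * t by rewrite /u distrC.
have vE : v = y + (a * (c * t)) *: e + u by rewrite /u addrC subrK.
have act0 : 0 < a * (c * t) by apply: mulr_gt0 => //; exact: mulr_gt0.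
have vy : `|v - y| < t.
  have -> : v - y = (a * (c * t)) *: e + u by rewrite {1}vE -(addrA y) (addrC y) addrK.
  apply: le_lt_trans (ler_normD _ _) _.
  rewrite normrZ (ger0_norm (ltW act0)).
  have ct0 : 0 < c * t by rewrite mulr_gt0.
  have le1 : a * (c * t) * `|e| <= a * (c * t) * K2.
    by rewrite ler_wpM2l// ltW.
  apply: (@lt_le_trans _ _ (c * (a * K2 + 1) * t)); first lra.
  rewrite ler_piMl ?(ltW t0)// (le_trans _ dK)// ler_wpM2r// ltW//.
split; first by rewrite distrC.
apply/(chart v).
  apply: inchart; rewrite -[v](subrK y) -addrA.
  by apply: le_lt_trans (ler_normD _ _) _; lra.
have vQ : v *m Q = y *m Q + (a * (c * t)) *: delta_mx ord0 i + u *m Q.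
  by rewrite vE !mulmxDl -scalemxAl /e -mulmxA QtQ mulmx1.
have strict : M * `|u *m Q| < a * (c * t).
  apply: (@le_lt_trans _ _ (a * `|u|)); last by rewrite ltr_pM2l.
  by rewrite -mulrA ler_wpM2l//; lra.
have vQi : (v *m Q) ord0 i = (y *m Q) ord0 i + a * (c * t) + (u *m Q) ord0 i.
  by rewrite vQ !mxE !eqxx mulr1.
have col_close : `|col' i (v *m Q) - col' i (y *m Q)| <= `|u *m Q|.
  apply: norm_le_coord => // j; rewrite vQ !mxE.
  rewrite [_ == i]eq_sym (negbTE (neq_lift _ _)) andbF mulr0 addr0 addrC addKr.
  by have := coord_le_norm (u *m Q) (lift i j); rewrite mxE.
have gclose := gammaL (col' i (v *m Q)) (col' i (y *m Q)).
have gclose2 : L * euclidean_dist (col' i (v *m Q)) (col' i (y *m Q)) <=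
    `|L| * n%:R * `|u *m Q|.
  apply: (@le_trans _ _ (`|L| * euclidean_dist (col' i (v *m Q)) (col' i (y *m Q)))).
    by rewrite ler_wpM2r ?euclidean_dist_ge0// ler_norm.
  rewrite -mulrA ler_wpM2l//; apply: le_trans (euclidean_dist_le_norm _ _) _.
  by apply: ler_pM => //; rewrite ler_nat leq_pred.
have ui := coord_le_norm (u *m Q) i.
rewrite vQi.
have g1 : gamma (col' i (v *m Q)) - gamma (col' i (y *m Q)) <= `|L| * n%:R * `|u *m Q|.
  by apply: le_trans (ler_norm _) _; exact: le_trans gclose gclose2.
move: ui; rewrite ler_norml => /andP[ui _].
move: strict; rewrite mulrDl mul1r; lra.
Qed.

End corkscrew.

Section lipschitz_domains.
Context {R : realType} {n : nat}.
Implicit Types (U : set 'rV[R]_n) (x y z : 'rV[R]_n).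

(** Interior and boundary points give the property near each point of the
    compact closure of [U], with a constant depending on the point; compactness
    removes that dependence. *)
Lemma lipschitz_corkscrew U : bounded_lipschitz_domain U ->
  exists2 e, 0 < e & forall y, corkscrew U e y.
Proof.
move=> [_ oU _ bU lip].
have cl_bounded : bounded_set (closure U).
  have [M [Mreal UM]] := bU; exists (M + 1); split; first by rewrite realD.
  move=> N MN x Ux.
  have d0 : 0 < N - (M + 1) by rewrite subr_gt0.
  have [v [Uv xv]] := Ux _ (nbhsx_ballx x _ d0).
  have vM : `|v| <= M + 1 by apply: UM => //; rewrite ltrDl.
  move: xv; rewrite mx_norm_ball /ball_/= => xv.
  by have := ler_distD v x 0; rewrite !subr0; lra.
have cl_compact := bounded_closed_compact cl_bounded (@closed_closure _ U).
have : \forall e \near (0 : R)^'+, closure U `<=` (fun y => corkscrew U e y).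
  move/compact_near_coveringP : cl_compact; apply => x Ux.
  have [d d0 dP] : exists2 d, 0 < d &
      forall e y, 0 < e <= d -> ball x d y -> corkscrew U e y.
    have [xU|xU] := pselect (U x); first exact: corkscrew_interior.
    apply: corkscrew_boundary; apply: lip; split => // /interior_subset.
    exact: xU.
  exists (ball x d, [set e | 0 < e <= d]) => /=.
    split; first exact: nbhsx_ballx.
    near=> e; apply/andP; split; near: e; [exact: nbhs_right_gt|exact: nbhs_right_le].
  by move=> [y e] /= [xy ed]; exact: dP.
move=> He; have : \forall e \near (0 : R)^'+,
    0 < e /\ closure U `<=` (fun y => corkscrew U e y).
  near=> e; split; near: e => //; exact: nbhs_right_gt.
move=> /filter_ex[e [e0 eP]]; exists e => // y Uy.
exact: (eP y (subset_closure Uy)).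
Unshelve. all: by end_near. Qed.

(** A Euclidean ball of radius [r] contains a cube of radius [r / n], and the
    corkscrew property gives a smaller cube inside both it and [U]. *)
Lemma lipschitz_density U : (0 < n)%N -> bounded_lipschitz_domain U ->
  exists c r0 : R, [/\ 0 < c, 0 < r0 & forall x (r : R), U x -> 0 < r <= r0 ->
    ((c * r `^ n%:R)%:E <=
     lebesgue_rV R n (U `&` [set y | (euclidean_dist x y < r)%R]))%E].
Proof.
move=> n0 HU; have [e e0 eP] := lipschitz_corkscrew HU.
have [_ oU _ _ _] := HU.
have n0' : 0 < n%:R :> R by rewrite ltr0n.
exists ((2 * (e / n%:R)) ^+ n), e; split => //.
  by rewrite exprn_gt0// mulr_gt0// divr_gt0.
move=> x r Ux /andP[r0 re].
have t0 : 0 < r / n%:R by rewrite divr_gt0.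
have te : r / n%:R <= e.
  by rewrite ler_pdivrMr// (le_trans re)// ler_peMr ?(ltW e0)// ler1n.
have [z zU] := eP x Ux (r / n%:R) (introT andP (conj t0 te)).
have er0 : 0 < e * (r / n%:R) by rewrite mulr_gt0.
have -> : (2 * (e / n%:R)) ^+ n * r `^ n%:R = (2 * (e * (r / n%:R))) ^+ n.
  by rewrite powR_mulrn ?(ltW r0)// -exprMn; congr (_ ^+ n); ring.
rewrite -(borel_lebesgue_ball z er0) -lebesgue_rV_borel; last exact: measurable_ball_rV.
apply: le_measure; rewrite ?inE.
- by apply: measurable_lebesgue_space; exact: measurable_ball_rV.
- have mU := measurable_lebesgue_space (open_measurable_rV oU).
  exact: (measurable_ballU mU measurable_euclidean_dist).
- move=> v /zU[]; rewrite mx_norm_ball /ball_/= => xv Uv; split => //=.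
  apply: le_lt_trans (euclidean_dist_le_norm _ _) _.
  by rewrite mulrC -ltr_pdivlMr.
Qed.

Lemma bounded_coords U : bounded_set U ->
  exists2 A, 0 < A & forall x, U x -> forall i, `|x ord0 i| <= A.
Proof.
move=> [M [Mreal UM]]; exists (`|M| + 1) => [|x Ux i]; first by rewrite ltr_wpDl.
apply: le_trans (coord_le_norm x i) (UM _ _ x Ux).
by rewrite (le_lt_trans (ler_norm M))// ltrDl.
Qed.

Lemma bounded_lebesgue_finite U : bounded_set U -> measurable U ->
  (lebesgue_rV R n U < +oo)%E.
Proof.
move=> /bounded_coords[A A0 UA] mU.
have A1 : 0 < A + 1 by rewrite addr_gt0.
apply: (@le_lt_trans _ _ (lebesgue_rV R n (ball 0 (A + 1)))).
  apply: le_measure; rewrite ?inE.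
  - exact: measurable_lebesgue_space.
  - by apply: measurable_lebesgue_space; exact: measurable_ball_rV.
  - move=> x Ux; rewrite ball_rVE// => i; rewrite mxE sub0r normrN.
    by rewrite (le_lt_trans (UA x Ux i))// ltrDl.
rewrite lebesgue_rV_borel; last exact: measurable_ball_rV.
by rewrite borel_lebesgue_ball// ltry.
Qed.

Lemma bounded_totally_bounded U e : bounded_set U -> 0 < e ->
  exists (I : finType) (B : I -> set 'rV[R]_n),
    (forall x, U x -> exists i, B i x) /\
    forall i x y, B i x -> B i y -> euclidean_dist x y < e.
Proof.
move=> /bounded_coords[A A0 UA] e0.
pose d := e / (n%:R + 1).
have n1 : 0 < n%:R + 1 :> R by rewrite ltr_wpDl.
have d0 : 0 < d by rewrite divr_gt0.
have [M [code codeP]] := quantization A d0.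
exists {ffun 'I_n -> 'I_M.+1}, (fun k => [set x | U x /\
  k = [ffun i => code (x ord0 i)]]); split=> [x Ux|k x y [Ux ->] [Uy]].
  by exists [ffun i => code (x ord0 i)].
move=> /ffunP xy; apply: le_lt_trans (euclidean_dist_le_norm _ _) _.
apply: (@le_lt_trans _ _ (n%:R * d)).
  rewrite ler_wpM2l//; apply: norm_le_coord => [|i]; first exact: ltW.
  rewrite !mxE; apply: codeP; [exact: UA|exact: UA|].
  by have := xy i; rewrite !ffunE.
by rewrite mulrCA gtr_pMr// ltr_pdivrMr// mul1r ltrDl.
Qed.

End lipschitz_domains.

(** * The compact embedding *)

Section sobolev_norms.
Context {R : realType} {n : nat}.

(** Passing from the quasinorm to the two integrals that it is made of. The
    summand [1] makes the bound positive. *)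
Lemma sobolev_ballP (U : set 'rV[R]_n) (h q M : R) f : 0 < q ->
  lebesgue_measurable_on U f -> (sobolev_norm U h q f <= M%:E)%E ->
  sobolev_ball (@sf_lebesgue R n) (@euclidean_dist R n) U n%:R h q (M `^ q + 1) f.
Proof.
move=> q0 mf fM.
have i0 : (0 <= int_pow U q f)%E.
  by apply: integral_ge0 => x _; rewrite lee_fin powR_ge0.
have g0 : (0 <= gagliardo U h q f)%E.
  apply: integral_ge0 => x _; apply: integral_ge0 => y _.
  by rewrite lee_fin divr_ge0 ?powR_ge0.
have : (int_pow U q f + gagliardo U h q f <= (M `^ q + 1)%:E)%E.
  move: fM; rewrite /sobolev_norm.
  have : (0 <= int_pow U q f + gagliardo U h q f)%E by rewrite adde_ge0.
  case: (int_pow U q f + gagliardo U h q f)%E => [u| |] // u0; last first.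
    by rewrite poweRyr ?invr_eq0 ?gt_eqF// leye_eq.
  rewrite poweR_EFin !lee_fin => uM.
  rewrite lee_fin in u0.
  have M0 : 0 <= M by apply: le_trans uM; exact: powR_ge0.
  have : u <= M `^ q.
    by rewrite -[q]invrK; apply: powR_le_root; rewrite ?invr_gt0.
  by lra.
move=> igM; split => //.
- by apply: le_trans igM; rewrite leeDl.
- by apply: le_trans igM; rewrite leeDr.
Qed.

End sobolev_norms.

(** The condition [qt < qstar] says that [qt] times the reciprocal of the critical
    exponent is less than one, the form used in the metric setting. *)
Theorem lemma2p3 (R : realType) (n : nat) (U : set 'rV[R]_n) (h q : R)
    (hn : (2 <= n)%N) (hU : bounded_lipschitz_domain U)
    (hh : 0 < h < 1) (hq : 0 < q < n%:R / h) :
  let qstar := n%:R * q / (n%:R - h * q) in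
  forall qt : R, q <= qt < qstar -> compactly_embedded U h q qt.
Proof.
move=> qstar p /andP[qp pq].
have [/andP[h0 _] /andP[q0 qn]] := (hh, hq).
have [_ oU _ bU _] := hU.
have n0 : 0 < n%:R :> R by rewrite ltr0n; exact: leq_trans hn.
have hqn : h * q < n%:R by rewrite mulrC -ltr_pdivlMr.
have p0 : 0 < p by apply: lt_le_trans qp.
have bp1 : (1 - h * q / n%:R) / q * p < 1.
  move: pq; rewrite /qstar ltr_pdivlMr ?subr_gt0// => pq.
  have -> : (1 - h * q / n%:R) / q * p = p * (n%:R - h * q) / (n%:R * q).
    by field; rewrite !gt_eqF.
  by rewrite ltr_pdivrMr ?mulr_gt0// mul1r.
have mU := measurable_lebesgue_space (open_measurable_rV oU).
have Ufin : (sf_lebesgue U < +oo)%E.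
  exact: bounded_lebesgue_finite bU (open_measurable_rV oU).
have [c [r0 [c0 r0_gt0 dens]]] := lipschitz_density (ltnW hn) hU.
have M0 (M : R) : 0 < M `^ q + 1 by rewrite ltr_wpDl ?powR_ge0.
split.
  move=> f [mf fW]; split => //.
  have fW0 : (0 <= sobolev_norm U h q f)%E by exact: poweR_ge0.
  have fM : (sobolev_norm U h q f <= (fine (sobolev_norm U h q f))%:E)%E.
    by rewrite fineK// ge0_fin_numE.
  exact: (sobolev_ball_subcritical (mu := @sf_lebesgue R n) mU
    measurable_euclidean_dist q0 h0 n0
    (@euclidean_dist_ge0 R n) (@euclidean_dist_eq0 R n)
    (@euclidean_dist_triangle R n) c0 r0_gt0 dens hqn Ufin (M0 _) p0 bp1
    (sobolev_ballP q0 mf fM)).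
move=> f_ fW [M fM].
have [phi [phi_incr [f [mf fp] fcvg]]] :=
  sobolev_ball_compact (mu := @sf_lebesgue R n) mU
    measurable_euclidean_dist q0 h0 n0
    (@euclidean_dist_ge0 R n) (@euclidean_dist_eq0 R n)
    (@euclidean_dist_triangle R n) c0 r0_gt0 dens hqn
    (fun e e0 => bounded_totally_bounded bU e0) Ufin (M0 M) p0 bp1
    (fun j => sobolev_ballP q0 (fW j).1 (fM j)).
by exists phi; split => //; exists f.
Qed.
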